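(* Let $K$ be an arbitrary field, let $s\ge2$ be an integer, and let $\mathbf{W}_s$ be the variety of Poisson algebras over $K$ defined by the identity $$\{X_1,X_2\}\cdot\{X_3,X_4\}\cdots\{X_{2s-1},X_{2s}\}\equiv0.$$ Then its complexity function $\mathcal{C}(\mathbf{W}_s,z)=\sum_{n=0}^\infty\frac{c_n(\mathbf{W}_s)}{n!}z^n$ is equal to each of the following: (1) $\displaystyle \mathcal{C}(\mathbf{W}_s,z)=\exp(z)\bigg(1+\sum_{k=1}^{s-1}\frac1{k!}\big(-z-\ln(1-z)\big)^k\bigg)$; (2) $\displaystyle \mathcal{C}(\mathbf{W}_s,z)=\frac1{1-z}-\exp(z)\bigg(\sum_{k=s}^{\infty}\frac1{k!}\Big(\sum_{n=2}^\infty\frac{z^n}{n}\Big)^k\bigg)$.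
   Context: A Poisson algebra over $K$ is a $K$-vector space $A$ with two $K$-bilinear operations: a commutative associative multiplication with unit $a\cdot b$, and a Lie bracket $\{a,b\}$ (the Poisson bracket), related by the Leibniz rule $\{a\cdot b,c\}=a\cdot\{b,c\}+b\cdot\{a,c\}$. Let $X=\{X_i\mid i\in\mathbb{N}\}$ and let $L(X)$ be the free Lie algebra on $X$. The free Poisson algebra on $X$ is the symmetric algebra $F(X)=S(L(X))$ with the Poisson bracket extending the bracket of $L(X)$ by the Leibniz rule. Let $P_n\subset F(X)$ be the span of all multilinear monomials of degree $n$ in $X_1,\dots,X_n$ (products of Lie commutators in which each of $X_1,\dots,X_n$ occurs exactly once). For a variety $\mathbf{W}$ of Poisson algebras, let $F(\mathbf{W},X)$ be its relatively free algebra on $X$ and $\phi:F(X)\to F(\mathbf{W},X)$ the natural epimorphism. The (ordinary) codimension sequence is $c_n(\mathbf{W})=\dim_K\phi(P_n)$, $n\ge 0$. All equalities are between power series in $z$, with $-\ln(1-z)=\sum_{n\ge1}z^n/n$. *)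

(* Defs.v *)
From HB Require Import structures.
From mathcomp Require Import all_boot all_order all_algebra.
From mathcomp Require Import generic_quotient.
From mathcomp Require Import boolp classical_sets.
From mathcomp Require Import ring.

Set Implicit Arguments.
Unset Strict Implicit.
Unset Printing Implicit Defensive.

Import GRing.Theory.

Local Open Scope ring_scope.
Local Open Scope quotient_scope.
Local Open Scope classical_set_scope.

(* The bracket is alternating rather than merely antisymmetric, so that the
   axioms are the right ones in characteristic 2. *)
HB.mixin Record Lmodule_isLie (K : fieldType) L of GRing.Lmodule K L := {
  lie : L -> L -> L;
  linear_liel : forall y, linear (lie^~ y);
  linear_lier : forall x, linear (lie x);
  liexx : forall x, lie x x = 0;
  jacobi : forall x y z,
    lie x (lie y z) + lie y (lie z x) + lie z (lie x y) = 0
}.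

#[short(type="lieAlgType")]
HB.structure Definition LieAlgebra (K : fieldType) :=
  { L of GRing.Lmodule K L & Lmodule_isLie K L }.

(* As everywhere in MathComp, comAlgType requires 1 != 0. The zero algebra,
   which belongs to every variety, is thus left out; it satisfies all
   identities, hence has no influence on the identities of a variety. *)
HB.mixin Record Lie_isPoisson (K : fieldType) A
    of GRing.ComAlgebra K A & LieAlgebra K A := {
  leibniz : forall a b c : A, lie (a * b) c = a * lie b c + b * lie a c
}.

#[short(type="poissonAlgType")]
HB.structure Definition PoissonAlgebra (K : fieldType) :=
  { A of GRing.ComAlgebra K A & LieAlgebra K A & Lie_isPoisson K A }.

Definition lie_morphism (K : fieldType) (L M : lieAlgType K) (h : L -> M) :=
  linear h /\ {morph h : x y / lie x y}.

Definition poisson_morphism (K : fieldType) (A B : poissonAlgType K)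
    (h : A -> B) :=
  [/\ linear h, monoid_morphism h & {morph h : x y / lie x y}].

Section LieTheory.
Variables (K : fieldType) (L : lieAlgType K).
Implicit Types x y z : L.

Lemma lieDl x y z : lie (x + y) z = lie x z + lie y z.
Proof. by have := linear_liel z 1 x y; rewrite !scale1r. Qed.
Lemma lieDr x y z : lie x (y + z) = lie x y + lie x z.
Proof. by have := linear_lier x 1 y z; rewrite !scale1r. Qed.
Lemma lie0l x : lie 0 x = 0.
Proof. by apply: (addIr (lie 0 x)); rewrite -lieDl !add0r. Qed.
Lemma lie0r x : lie x 0 = 0.
Proof. by apply: (addIr (lie x 0)); rewrite -lieDr !add0r. Qed.
Lemma lieZl a x y : lie (a *: x) y = a *: lie x y.
Proof. by rewrite -[a *: x]addr0 linear_liel lie0l addr0. Qed.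
Lemma lieZr a x y : lie x (a *: y) = a *: lie x y.
Proof. by rewrite -[a *: y]addr0 linear_lier lie0r addr0. Qed.
Lemma lie_antisym x y : lie x y = - lie y x.
Proof.
apply/eqP; rewrite -addr_eq0; apply/eqP.
by have := liexx (x + y); rewrite lieDl !lieDr !liexx add0r addr0.
Qed.
End LieTheory.

Section FreeLie.
Variables (K : fieldType) (X : Type).

Inductive lterm : Type :=
| LVar of X
| LZero
| LAdd of lterm & lterm
| LScale of K & lterm
| LLie of lterm & lterm.

HB.instance Definition _ := gen_eqMixin lterm.
HB.instance Definition _ := gen_choiceMixin lterm.

Inductive lterm_equiv : lterm -> lterm -> Prop :=
| lequiv_refl t : lterm_equiv t t
| lequiv_sym t u : lterm_equiv t u -> lterm_equiv u t
| lequiv_tr t u v : lterm_equiv t u -> lterm_equiv u v -> lterm_equiv t v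
| lequiv_congD t t' u u' : lterm_equiv t t' -> lterm_equiv u u' ->
    lterm_equiv (LAdd t u) (LAdd t' u')
| lequiv_congZ a t t' : lterm_equiv t t' ->
    lterm_equiv (LScale a t) (LScale a t')
| lequiv_congL t t' u u' : lterm_equiv t t' -> lterm_equiv u u' ->
    lterm_equiv (LLie t u) (LLie t' u')
| lequiv_addA t u v : lterm_equiv (LAdd t (LAdd u v)) (LAdd (LAdd t u) v)
| lequiv_addC t u : lterm_equiv (LAdd t u) (LAdd u t)
| lequiv_add0 t : lterm_equiv (LAdd LZero t) t
| lequiv_addN t : lterm_equiv (LAdd (LScale (-1) t) t) LZero
| lequiv_scaleA a b t : lterm_equiv (LScale a (LScale b t)) (LScale (a * b) t)
| lequiv_scale1 t : lterm_equiv (LScale 1 t) t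
| lequiv_scaleDr a t u :
    lterm_equiv (LScale a (LAdd t u)) (LAdd (LScale a t) (LScale a u))
| lequiv_scaleDl t a b :
    lterm_equiv (LScale (a + b) t) (LAdd (LScale a t) (LScale b t))
| lequiv_linl v a t u : lterm_equiv (LLie (LAdd (LScale a t) u) v)
                                 (LAdd (LScale a (LLie t v)) (LLie u v))
| lequiv_linr v a t u : lterm_equiv (LLie v (LAdd (LScale a t) u))
                                 (LAdd (LScale a (LLie v t)) (LLie v u))
| lequiv_liexx t : lterm_equiv (LLie t t) LZero
| lequiv_jacobi t u v :
    lterm_equiv (LAdd (LAdd (LLie t (LLie u v)) (LLie u (LLie v t)))
                      (LLie v (LLie t u))) LZero.

Definition lterm_eq : rel lterm := fun t u => `[< lterm_equiv t u >].

Lemma lterm_eq_equiv : equiv_class_of lterm_eq.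
Proof.
split=> [t|t u|u t v].
- exact/asboolP/lequiv_refl.
- by apply/asboolP/asboolP; apply: lequiv_sym.
- by move=> /asboolP tu /asboolP uv; apply/asboolP; apply: lequiv_tr uv.
Qed.

Canonical lterm_equiv_rel := EquivRelPack lterm_eq_equiv.

Definition freeLie := {eq_quot lterm_eq}.

HB.instance Definition _ := Choice.on freeLie.

Definition freeLie_pi (t : lterm) : freeLie := \pi_({eq_quot lterm_eq}) t.
Definition freeLie_repr (u : freeLie) : lterm := repr u.

Lemma freeLie_eqP t u : freeLie_pi t = freeLie_pi u <-> lterm_equiv t u.
Proof.
exact: iff_trans (rwP (eqmodP lterm_equiv_rel t u)) (iff_sym (rwP (asboolP _))).
Qed.

Lemma freeLie_reprK t : lterm_equiv (freeLie_repr (freeLie_pi t)) t.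
Proof. by apply/freeLie_eqP; rewrite /freeLie_pi /freeLie_repr reprK. Qed.

Lemma freeLieW (P : freeLie -> Prop) :
  (forall t, P (freeLie_pi t)) -> forall u, P u.
Proof. by move=> Pt; elim/quotW. Qed.

Definition freeLie_zero : freeLie := freeLie_pi LZero.
Definition freeLie_add (u v : freeLie) : freeLie :=
  freeLie_pi (LAdd (freeLie_repr u) (freeLie_repr v)).
Definition freeLie_scale a (u : freeLie) : freeLie :=
  freeLie_pi (LScale a (freeLie_repr u)).
Definition freeLie_lie (u v : freeLie) : freeLie :=
  freeLie_pi (LLie (freeLie_repr u) (freeLie_repr v)).
Definition freeLie_var (x : X) : freeLie := freeLie_pi (LVar x).

Lemma freeLie_addE t u :
  freeLie_add (freeLie_pi t) (freeLie_pi u) = freeLie_pi (LAdd t u).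
Proof. by apply/freeLie_eqP; apply: lequiv_congD; apply: freeLie_reprK. Qed.
Lemma freeLie_scaleE a t :
  freeLie_scale a (freeLie_pi t) = freeLie_pi (LScale a t).
Proof. by apply/freeLie_eqP; apply: lequiv_congZ; apply: freeLie_reprK. Qed.
Lemma freeLie_lieE t u :
  freeLie_lie (freeLie_pi t) (freeLie_pi u) = freeLie_pi (LLie t u).
Proof. by apply/freeLie_eqP; apply: lequiv_congL; apply: freeLie_reprK. Qed.

Let E := (freeLie_addE, freeLie_scaleE, freeLie_lieE).

Lemma freeLie_addA : associative freeLie_add.
Proof.
by do 3![elim/freeLieW=> ?]; rewrite !E; apply/freeLie_eqP; constructor.
Qed.
Lemma freeLie_addC : commutative freeLie_add.
Proof.
by do 2![elim/freeLieW=> ?]; rewrite !E; apply/freeLie_eqP; constructor.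
Qed.
Lemma freeLie_add0 : left_id freeLie_zero freeLie_add.
Proof. by elim/freeLieW=> ?; rewrite !E; apply/freeLie_eqP; constructor. Qed.
Lemma freeLie_addN :
  left_inverse freeLie_zero (freeLie_scale (-1)) freeLie_add.
Proof. by elim/freeLieW=> ?; rewrite !E; apply/freeLie_eqP; constructor. Qed.

HB.instance Definition _ := GRing.isZmodule.Build freeLie
  freeLie_addA freeLie_addC freeLie_add0 freeLie_addN.

Lemma freeLie_scaleA a b u :
  freeLie_scale a (freeLie_scale b u) = freeLie_scale (a * b) u.
Proof.
by elim/freeLieW: u => ?; rewrite !E; apply/freeLie_eqP; constructor.
Qed.
Lemma freeLie_scale1 : left_id 1 freeLie_scale.
Proof. by elim/freeLieW=> ?; rewrite !E; apply/freeLie_eqP; constructor. Qed.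
Lemma freeLie_scaleDr : right_distributive freeLie_scale +%R.
Proof.
move=> a; do 2![elim/freeLieW=> ?]; rewrite /GRing.add/= !E.
by apply/freeLie_eqP; constructor.
Qed.
Lemma freeLie_scaleDl u : {morph freeLie_scale^~ u : a b / a + b}.
Proof.
move=> a b; elim/freeLieW: u => ?; rewrite [RHS]/GRing.add/= !E.
by apply/freeLie_eqP; constructor.
Qed.

HB.instance Definition _ := GRing.Zmodule_isLmodule.Build K freeLie
  freeLie_scaleA freeLie_scale1 freeLie_scaleDr freeLie_scaleDl.

Lemma freeLie_linl y : linear (freeLie_lie^~ y).
Proof.
move=> a; do 2![elim/freeLieW=> ?]; elim/freeLieW: y => ?.
rewrite /GRing.add/GRing.scale/= !E.
by apply/freeLie_eqP; constructor.
Qed.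
Lemma freeLie_linr x : linear (freeLie_lie x).
Proof.
move=> a; do 2![elim/freeLieW=> ?]; elim/freeLieW: x => ?.
rewrite /GRing.add/GRing.scale/= !E.
by apply/freeLie_eqP; constructor.
Qed.
Lemma freeLie_liexx x : freeLie_lie x x = 0.
Proof. by elim/freeLieW: x => ?; rewrite E; apply/freeLie_eqP; constructor. Qed.
Lemma freeLie_jacobi x y z :
  freeLie_lie x (freeLie_lie y z) + freeLie_lie y (freeLie_lie z x)
    + freeLie_lie z (freeLie_lie x y) = 0.
Proof.
elim/freeLieW: x => ?; elim/freeLieW: y => ?; elim/freeLieW: z => ?.
by rewrite /GRing.add/= !E; apply/freeLie_eqP; constructor.
Qed.

HB.instance Definition _ := Lmodule_isLie.Build K freeLie
  freeLie_linl freeLie_linr freeLie_liexx freeLie_jacobi.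

End FreeLie.

Section LinearFunctions.
Variables (R : pzRingType) (U V : lmodType R) (f : U -> V).
Hypothesis f_lin : linear f.

Lemma linD x y : f (x + y) = f x + f y.
Proof. by have := f_lin 1 x y; rewrite !scale1r. Qed.
Lemma lin0 : f 0 = 0.
Proof. by apply: (addIr (f 0)); rewrite -linD !add0r. Qed.
Lemma linZ a x : f (a *: x) = a *: f x.
Proof. by rewrite -[a *: x]addr0 f_lin lin0 addr0. Qed.
Lemma linN x : f (- x) = - f x.
Proof. by rewrite -scaleN1r linZ scaleN1r. Qed.
Lemma linB x y : f (x - y) = f x - f y.
Proof. by rewrite linD linN. Qed.

End LinearFunctions.

Section FreeLieUniversal.
Variables (K : fieldType) (X : Type) (M : lieAlgType K) (f : X -> M).

Fixpoint lterm_eval (t : lterm K X) : M :=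
  match t with
  | LVar x => f x
  | LZero => 0
  | LAdd t u => lterm_eval t + lterm_eval u
  | LScale a t => a *: lterm_eval t
  | LLie t u => lie (lterm_eval t) (lterm_eval u)
  end.

Lemma lterm_eval_equiv t u : lterm_equiv t u -> lterm_eval t = lterm_eval u.
Proof.
elim=> //= {t u}.
- by move=> t u v _ -> _ ->.
- by move=> t t' u u' _ -> _ ->.
- by move=> a t t' _ ->.
- by move=> t t' u u' _ -> _ ->.
- by move=> *; rewrite addrA.
- by move=> *; rewrite addrC.
- by move=> *; rewrite add0r.
- by move=> *; rewrite scaleN1r addNr.
- by move=> *; rewrite scalerA.
- by move=> *; rewrite scale1r.
- by move=> *; rewrite scalerDr.
- by move=> *; rewrite scalerDl.
- by move=> *; rewrite linear_liel.
- by move=> *; rewrite linear_lier.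
- by move=> *; rewrite liexx.
- by move=> *; rewrite jacobi.
Qed.

Definition freeLie_lift (u : freeLie K X) : M := lterm_eval (freeLie_repr u).

Lemma freeLie_liftE t : freeLie_lift (freeLie_pi t) = lterm_eval t.
Proof. by apply: lterm_eval_equiv; apply: freeLie_reprK. Qed.

Lemma freeLie_lift_var x : freeLie_lift (freeLie_var K x) = f x.
Proof. exact: freeLie_liftE. Qed.

Lemma freeLie_lift_morphism : lie_morphism freeLie_lift.
Proof.
split.
  move=> a; elim/freeLieW=> t; elim/freeLieW=> u.
  rewrite [X in freeLie_lift X]/GRing.add.
  rewrite [X in freeLie_lift (_ X _)]/GRing.scale.
  by rewrite /= freeLie_scaleE freeLie_addE !freeLie_liftE.
elim/freeLieW=> t; elim/freeLieW=> u.
by rewrite [X in freeLie_lift X]/lie /= freeLie_lieE !freeLie_liftE.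
Qed.

End FreeLieUniversal.

Lemma freeLie_piE (K : fieldType) (X : Type) (t : lterm K X) :
  freeLie_pi t = lterm_eval (@freeLie_var K X) t.
Proof.
elim: t => //= [t <- u <-|a t <-|t <- u <-].
- by rewrite [RHS]/GRing.add/= freeLie_addE.
- by rewrite [RHS]/GRing.scale/= freeLie_scaleE.
- by rewrite [RHS]/lie/= freeLie_lieE.
Qed.

Lemma freeLie_ind (K : fieldType) (X : Type) (P : freeLie K X -> Prop) :
    (forall x, P (freeLie_var K x)) -> P 0 ->
    (forall u v, P u -> P v -> P (u + v)) ->
    (forall a u, P u -> P (a *: u)) ->
    (forall u v, P u -> P v -> P (lie u v)) ->
  forall u, P u.
Proof.
move=> PX P0 PD PZ PL; elim/freeLieW=> t; rewrite freeLie_piE.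
by elim: t => //=; auto.
Qed.

Lemma freeLie_lift_unique (K : fieldType) (X : Type) (M : lieAlgType K)
    (g h : freeLie K X -> M) : lie_morphism g -> lie_morphism h ->
    (forall x, g (freeLie_var K x) = h (freeLie_var K x)) -> g =1 h.
Proof.
move=> [gl gL] [hl hL] gh.
apply: freeLie_ind => //.
- by rewrite (lin0 gl) (lin0 hl).
- by move=> u v gu gv; rewrite (linD gl) (linD hl) gu gv.
- by move=> a u gu; rewrite (linZ gl) (linZ hl) gu.
- by move=> u v gu gv; rewrite gL hL gu gv.
Qed.

Section SymmetricAlgebra.
Variables (K : fieldType) (V : lmodType K).

Inductive sterm : Type :=
| SIn of V
| SCst of K
| SAdd of sterm & sterm
| SMul of sterm & sterm.

HB.instance Definition _ := gen_eqMixin sterm.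
HB.instance Definition _ := gen_choiceMixin sterm.

Inductive sterm_equiv : sterm -> sterm -> Prop :=
| sequiv_refl t : sterm_equiv t t
| sequiv_sym t u : sterm_equiv t u -> sterm_equiv u t
| sequiv_tr t u v : sterm_equiv t u -> sterm_equiv u v -> sterm_equiv t v
| sequiv_congD t t' u u' : sterm_equiv t t' -> sterm_equiv u u' ->
    sterm_equiv (SAdd t u) (SAdd t' u')
| sequiv_congM t t' u u' : sterm_equiv t t' -> sterm_equiv u u' ->
    sterm_equiv (SMul t u) (SMul t' u')
| sequiv_addA t u v : sterm_equiv (SAdd t (SAdd u v)) (SAdd (SAdd t u) v)
| sequiv_addC t u : sterm_equiv (SAdd t u) (SAdd u t)
| sequiv_add0 t : sterm_equiv (SAdd (SCst 0) t) t
| sequiv_addN t : sterm_equiv (SAdd (SMul (SCst (-1)) t) t) (SCst 0)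
| sequiv_mulA t u v : sterm_equiv (SMul t (SMul u v)) (SMul (SMul t u) v)
| sequiv_mulC t u : sterm_equiv (SMul t u) (SMul u t)
| sequiv_mul1 t : sterm_equiv (SMul (SCst 1) t) t
| sequiv_mulDl t u v :
    sterm_equiv (SMul (SAdd t u) v) (SAdd (SMul t v) (SMul u v))
| sequiv_cstD a b : sterm_equiv (SCst (a + b)) (SAdd (SCst a) (SCst b))
| sequiv_cstM a b : sterm_equiv (SCst (a * b)) (SMul (SCst a) (SCst b))
| sequiv_inl a u v :
    sterm_equiv (SIn (a *: u + v)) (SAdd (SMul (SCst a) (SIn u)) (SIn v)).

Definition sterm_eq : rel sterm := fun t u => `[< sterm_equiv t u >].

Lemma sterm_eq_equiv : equiv_class_of sterm_eq.
Proof.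
split=> [t|t u|u t v].
- exact/asboolP/sequiv_refl.
- by apply/asboolP/asboolP; apply: sequiv_sym.
- by move=> /asboolP tu /asboolP uv; apply/asboolP; apply: sequiv_tr uv.
Qed.

Canonical sterm_equiv_rel := EquivRelPack sterm_eq_equiv.

Definition symalg := {eq_quot sterm_eq}.

HB.instance Definition _ := Choice.on symalg.

Definition sym_pi (t : sterm) : symalg := \pi_({eq_quot sterm_eq}) t.
Definition sym_repr (u : symalg) : sterm := repr u.

Lemma sym_eqP t u : sym_pi t = sym_pi u <-> sterm_equiv t u.
Proof.
exact: iff_trans (rwP (eqmodP sterm_equiv_rel t u)) (iff_sym (rwP (asboolP _))).
Qed.

Lemma sym_reprK t : sterm_equiv (sym_repr (sym_pi t)) t.
Proof. by apply/sym_eqP; rewrite /sym_pi /sym_repr reprK. Qed.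

Lemma symW (P : symalg -> Prop) : (forall t, P (sym_pi t)) -> forall u, P u.
Proof. by move=> Pt; elim/quotW. Qed.

(* Evaluation to the constant term, needed for 1 != 0. *)
Fixpoint sterm_aug (t : sterm) : K :=
  match t with
  | SIn _ => 0
  | SCst a => a
  | SAdd t u => sterm_aug t + sterm_aug u
  | SMul t u => sterm_aug t * sterm_aug u
  end.

Lemma sterm_aug_equiv t u : sterm_equiv t u -> sterm_aug t = sterm_aug u.
Proof.
elim=> //= {t u}.
- by move=> t u v _ -> _ ->.
- by move=> t t' u u' _ -> _ ->.
- by move=> t t' u u' _ -> _ ->.
all: by move=> *; ring.
Qed.

Definition sym_cst a : symalg := sym_pi (SCst a).
Definition sym_in v : symalg := sym_pi (SIn v).
Definition sym_add (u v : symalg) : symalg :=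
  sym_pi (SAdd (sym_repr u) (sym_repr v)).
Definition sym_mul (u v : symalg) : symalg :=
  sym_pi (SMul (sym_repr u) (sym_repr v)).

Lemma sym_addE t u : sym_add (sym_pi t) (sym_pi u) = sym_pi (SAdd t u).
Proof. by apply/sym_eqP; apply: sequiv_congD; apply: sym_reprK. Qed.
Lemma sym_mulE t u : sym_mul (sym_pi t) (sym_pi u) = sym_pi (SMul t u).
Proof. by apply/sym_eqP; apply: sequiv_congM; apply: sym_reprK. Qed.

Let E := (sym_addE, sym_mulE).

Lemma sym_addA : associative sym_add.
Proof. by do 3![elim/symW=> ?]; rewrite !E; apply/sym_eqP; constructor. Qed.
Lemma sym_addC : commutative sym_add.
Proof. by do 2![elim/symW=> ?]; rewrite !E; apply/sym_eqP; constructor. Qed.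
Lemma sym_add0 : left_id (sym_cst 0) sym_add.
Proof. by elim/symW=> ?; rewrite /sym_cst !E; apply/sym_eqP; constructor. Qed.
Lemma sym_addN : left_inverse (sym_cst 0) (sym_mul (sym_cst (-1))) sym_add.
Proof. by elim/symW=> ?; rewrite /sym_cst !E; apply/sym_eqP; constructor. Qed.

HB.instance Definition _ := GRing.isZmodule.Build symalg
  sym_addA sym_addC sym_add0 sym_addN.

Lemma sym_mulA : associative sym_mul.
Proof. by do 3![elim/symW=> ?]; rewrite !E; apply/sym_eqP; constructor. Qed.
Lemma sym_mulC : commutative sym_mul.
Proof. by do 2![elim/symW=> ?]; rewrite !E; apply/sym_eqP; constructor. Qed.
Lemma sym_mul1 : left_id (sym_cst 1) sym_mul.
Proof. by elim/symW=> ?; rewrite /sym_cst !E; apply/sym_eqP; constructor. Qed.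
Lemma sym_mulDl : left_distributive sym_mul +%R.
Proof.
do 3![elim/symW=> ?]; rewrite /GRing.add/= !E.
by apply/sym_eqP; constructor.
Qed.
Lemma sym_oner_neq0 : sym_cst 1 != 0.
Proof. by apply/eqP => /sym_eqP/sterm_aug_equiv/eqP; rewrite oner_eq0. Qed.

HB.instance Definition _ := GRing.Zmodule_isComNzRing.Build symalg
  sym_mulA sym_mulC sym_mul1 sym_mulDl sym_oner_neq0.

Definition sym_scale a (u : symalg) : symalg := sym_cst a * u.

Lemma sym_cstD a b : sym_cst (a + b) = sym_cst a + sym_cst b.
Proof. by rewrite [RHS]E; apply/sym_eqP; constructor. Qed.
Lemma sym_cstM a b : sym_cst (a * b) = sym_cst a * sym_cst b.
Proof. by rewrite [RHS]E; apply/sym_eqP; constructor. Qed.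
Lemma sym_scaleA a b u : sym_scale a (sym_scale b u) = sym_scale (a * b) u.
Proof. by rewrite /sym_scale sym_cstM mulrA. Qed.
Lemma sym_scale1 : left_id 1 sym_scale.
Proof. exact: mul1r. Qed.
Lemma sym_scaleDr : right_distributive sym_scale +%R.
Proof. by move=> a u v; apply: mulrDr. Qed.
Lemma sym_scaleDl u : {morph sym_scale^~ u : a b / a + b}.
Proof. by move=> a b; rewrite /sym_scale sym_cstD mulrDl. Qed.

HB.instance Definition _ := GRing.Zmodule_isLmodule.Build K symalg
  sym_scaleA sym_scale1 sym_scaleDr sym_scaleDl.

Lemma sym_scaleAl (a : K) (u v : symalg) : a *: (u * v) = (a *: u) * v.
Proof. exact: mulrA. Qed.

HB.instance Definition _ := GRing.Lmodule_isLalgebra.Build K symalg sym_scaleAl.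
HB.instance Definition _ := GRing.Lalgebra_isComAlgebra.Build K symalg.

Lemma sym_scaleE a (u : symalg) : a *: u = sym_cst a * u.
Proof. by []. Qed.

Lemma sym_cstE a : sym_cst a = a%:A.
Proof. by rewrite sym_scaleE mulr1. Qed.

Lemma sym_piD t u : sym_pi (SAdd t u) = sym_pi t + sym_pi u.
Proof. by rewrite [RHS]sym_addE. Qed.

Lemma sym_piM t u : sym_pi (SMul t u) = sym_pi t * sym_pi u.
Proof. by rewrite [RHS]sym_mulE. Qed.

Lemma sym_in_linear : linear sym_in.
Proof.
move=> a u v; rewrite sym_scaleE /sym_in /sym_cst -sym_piM -sym_piD.
by apply/sym_eqP; constructor.
Qed.

End SymmetricAlgebra.

Section SymUniversal.
Variables (K : fieldType) (V : lmodType K) (A : comAlgType K) (f : V -> A).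
Hypothesis f_lin : linear f.

Fixpoint sterm_eval (t : sterm V) : A :=
  match t with
  | SIn v => f v
  | SCst a => a%:A
  | SAdd t u => sterm_eval t + sterm_eval u
  | SMul t u => sterm_eval t * sterm_eval u
  end.

Lemma sterm_eval_equiv t u : sterm_equiv t u -> sterm_eval t = sterm_eval u.
Proof.
elim=> //= {t u}.
- by move=> t u v _ -> _ ->.
- by move=> t t' u u' _ -> _ ->.
- by move=> t t' u u' _ -> _ ->.
- by move=> *; rewrite addrA.
- by move=> *; rewrite addrC.
- by move=> *; rewrite scale0r add0r.
- by move=> *; rewrite scale0r scaleN1r mulN1r addNr.
- by move=> *; rewrite mulrA.
- by move=> *; rewrite mulrC.
- by move=> *; rewrite scale1r mul1r.
- by move=> *; rewrite mulrDl.
- by move=> *; rewrite scalerDl.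
- by move=> *; rewrite -scalerAl mul1r scalerA.
- by move=> *; rewrite f_lin -scalerAl mul1r.
Qed.

Definition sym_lift (u : symalg V) : A := sterm_eval (sym_repr u).

Lemma sym_liftE t : sym_lift (sym_pi t) = sterm_eval t.
Proof. by apply: sterm_eval_equiv; apply: sym_reprK. Qed.

Lemma sym_lift_in v : sym_lift (sym_in v) = f v.
Proof. exact: sym_liftE. Qed.

Lemma sym_lift_linear : linear sym_lift.
Proof.
move=> a; elim/symW=> t; elim/symW=> u.
rewrite sym_scaleE /sym_cst -sym_piM -sym_piD !sym_liftE /=.
by rewrite -scalerAl mul1r.
Qed.

Lemma sym_lift_monoid_morphism : monoid_morphism sym_lift.
Proof.
split; first by rewrite [LHS]sym_liftE /= scale1r.
elim/symW=> t; elim/symW=> u.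
by rewrite -sym_piM !sym_liftE.
Qed.

End SymUniversal.

Lemma sym_piE (K : fieldType) (V : lmodType K) (t : sterm V) :
  sym_pi t = sterm_eval (@sym_in K V) t.
Proof.
elim: t => //= [a|t <- u <-|t <- u <-].
- exact: sym_cstE.
- exact: sym_piD.
- exact: sym_piM.
Qed.

Lemma sym_ind (K : fieldType) (V : lmodType K) (P : symalg V -> Prop) :
    (forall v, P (sym_in v)) -> (forall a, P a%:A) ->
    (forall u v, P u -> P v -> P (u + v)) ->
    (forall u v, P u -> P v -> P (u * v)) ->
  forall u, P u.
Proof.
move=> PV PK PD PM; elim/symW=> t; rewrite sym_piE.
by elim: t => //=; auto.
Qed.

(* Every linear map f : V -> S(V) extends uniquely to a derivation of S(V). *)
Section Derivation.
Variables (K : fieldType) (V : lmodType K) (f : V -> symalg V).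

Fixpoint sterm_der (t : sterm V) : symalg V :=
  match t with
  | SIn v => f v
  | SCst _ => 0
  | SAdd t u => sterm_der t + sterm_der u
  | SMul t u => sym_pi t * sterm_der u + sym_pi u * sterm_der t
  end.

Definition sym_der (u : symalg V) : symalg V := sterm_der (sym_repr u).

Hypothesis f_lin : linear f.

Lemma sterm_der_equiv t u : sterm_equiv t u -> sterm_der t = sterm_der u.
Proof.
have pC a : sym_pi (SCst V a) = a%:A by exact: sym_cstE.
elim=> //= {t u}.
- by move=> t u v _ -> _ ->.
- by move=> t t' u u' _ -> _ ->.
- by move=> t t' u u' /sym_eqP -> -> /sym_eqP -> ->.
- by move=> *; rewrite addrA.
- by move=> *; rewrite addrC.
- by move=> *; rewrite add0r.
- by move=> *; rewrite mulr0 addr0 pC scaleN1r mulN1r addNr.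
- by move=> *; rewrite !sym_piM; ring.
- by move=> *; rewrite addrC.
- by move=> *; rewrite mulr0 addr0 pC scale1r mul1r.
- by move=> *; rewrite !sym_piD; ring.
- by move=> *; rewrite addr0.
- by move=> *; rewrite !mulr0 addr0.
- by move=> *; rewrite f_lin pC mulr0 addr0 -scalerAl mul1r.
Qed.

Lemma sym_derE t : sym_der (sym_pi t) = sterm_der t.
Proof. by apply: sterm_der_equiv; apply: sym_reprK. Qed.

Lemma sym_der_in v : sym_der (sym_in v) = f v.
Proof. exact: sym_derE. Qed.

Lemma sym_derC a : sym_der a%:A = 0.
Proof. by rewrite -sym_cstE [LHS]sym_derE. Qed.

Lemma sym_derD : {morph sym_der : u v / u + v}.
Proof.
elim/symW=> t; elim/symW=> u.
by rewrite -sym_piD !sym_derE.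
Qed.

Lemma sym_derM u v : sym_der (u * v) = u * sym_der v + v * sym_der u.
Proof.
elim/symW: u => t; elim/symW: v => u.
by rewrite -sym_piM !sym_derE.
Qed.

Lemma sym_der_linear : linear sym_der.
Proof.
move=> a u v; rewrite sym_derD -[a *: u]mulr_algl sym_derM sym_derC.
by rewrite mulr0 addr0 mulr_algl.
Qed.

End Derivation.

Section SymPoisson.
Variables (K : fieldType) (L : lieAlgType K).
Implicit Types (a b : L) (u v w : symalg L).

Definition sym_ad a : symalg L -> symalg L :=
  sym_der (fun b => sym_in (lie a b)).

(* The Poisson bracket of S(L): v |-> {u, v} is the derivation mapping b in L
   to {u, b} = - {b, u}, and u |-> {b, u} is the derivation extending ad b. *)
Definition sym_lie u v : symalg L := sym_der (fun b => - sym_ad b u) v.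

Lemma sym_in_lie_linear a : linear (fun b => sym_in (lie a b)).
Proof. by move=> k b c; rewrite linear_lier sym_in_linear. Qed.

Lemma sym_ad_linear u : linear (fun a => sym_ad a u).
Proof.
elim/sym_ind: u => [b|c|u v uP vP|u v uP vP] k a a'; rewrite /sym_ad.
- rewrite !sym_der_in; try exact: sym_in_lie_linear.
  by rewrite linear_liel sym_in_linear.
- by rewrite !sym_derC; try exact: sym_in_lie_linear; rewrite scaler0 addr0.
- rewrite !sym_derD; try exact: sym_in_lie_linear.
  move: (uP k a a') (vP k a a'); rewrite /sym_ad => -> ->.
  by rewrite scalerDr addrACA.
- rewrite !sym_derM; try exact: sym_in_lie_linear.
  move: (uP k a a') (vP k a a'); rewrite /sym_ad => -> ->.
  by rewrite !mulrDr -!scalerAr scalerDr addrACA.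
Qed.

Lemma sym_adN_linear u : linear (fun a => - sym_ad a u).
Proof. by move=> k a b; rewrite sym_ad_linear opprD scalerN. Qed.

Lemma sym_lie_linr u : linear (sym_lie u).
Proof. exact: sym_der_linear (sym_adN_linear u). Qed.

Lemma sym_lieCr u k : sym_lie u k%:A = 0.
Proof. exact: sym_derC (sym_adN_linear u) k. Qed.

Lemma sym_lieMr u v w : sym_lie u (v * w) = v * sym_lie u w + w * sym_lie u v.
Proof. exact: sym_derM (sym_adN_linear u) v w. Qed.

Lemma sym_lie_inr u b : sym_lie u (sym_in b) = - sym_ad b u.
Proof. exact: sym_der_in (sym_adN_linear u) b. Qed.

Lemma sym_lie_in a b : sym_lie (sym_in a) (sym_in b) = sym_in (lie a b).
Proof.
rewrite sym_lie_inr [sym_ad _ _]sym_der_in; last exact: sym_in_lie_linear.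
by rewrite -(linN (@sym_in_linear _ L)) -lie_antisym.
Qed.

Lemma sym_lieDr u v w : sym_lie u (v + w) = sym_lie u v + sym_lie u w.
Proof. exact: linD (sym_lie_linr u) v w. Qed.

Lemma sym_lie_linl v : linear (sym_lie^~ v).
Proof.
elim/sym_ind: v => [b|c|v w vP wP|v w vP wP] k u u' /=.
- rewrite !sym_lie_inr.
  by rewrite [sym_ad b _](sym_der_linear (sym_in_lie_linear b)) opprD scalerN.
- by rewrite !sym_lieCr scaler0 addr0.
- by rewrite !sym_lieDr vP wP scalerDr addrACA.
- by rewrite !sym_lieMr vP wP !mulrDr -!scalerAr scalerDr addrACA.
Qed.

Lemma sym_lieDl u v w : sym_lie (u + v) w = sym_lie u w + sym_lie v w.
Proof. exact: linD (sym_lie_linl w) u v. Qed.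

Lemma sym_lieCl k v : sym_lie k%:A v = 0.
Proof.
elim/sym_ind: v => [b|c|v w vP wP|v w vP wP].
- by rewrite sym_lie_inr [sym_ad _ _]sym_derC ?oppr0//;
    apply: sym_in_lie_linear.
- exact: sym_lieCr.
- by rewrite sym_lieDr vP wP addr0.
- by rewrite sym_lieMr vP wP !mulr0 addr0.
Qed.

Lemma sym_leibniz u v w : sym_lie (u * v) w = u * sym_lie v w + v * sym_lie u w.
Proof.
elim/sym_ind: w => [b|c|w w' wP wP'|w w' wP wP'].
- rewrite !sym_lie_inr [sym_ad _ _]sym_derM; last exact: sym_in_lie_linear.
  by rewrite opprD !mulrN.
- by rewrite !sym_lieCr !mulr0 addr0.
- by rewrite !sym_lieDr wP wP'; ring.
- by rewrite !sym_lieMr wP wP'; ring.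
Qed.

Lemma sym_lie_antisym u v : sym_lie u v = - sym_lie v u.
Proof.
elim/sym_ind: u => [a|c|u u' uP uP'|u u' uP uP'].
- elim/sym_ind: v => [b|c|v v' vP vP'|v v' vP vP'].
  + by rewrite !sym_lie_in lie_antisym (linN (@sym_in_linear _ L)).
  + by rewrite sym_lieCr sym_lieCl oppr0.
  + by rewrite sym_lieDr sym_lieDl vP vP' opprD.
  + by rewrite sym_lieMr sym_leibniz vP vP'; ring.
- by rewrite sym_lieCr sym_lieCl oppr0.
- by rewrite sym_lieDr sym_lieDl uP uP' opprD.
- by rewrite sym_lieMr sym_leibniz uP uP'; ring.
Qed.

Lemma sym_liexx u : sym_lie u u = 0.
Proof.
elim/sym_ind: u => [a|c|u v uP vP|u v uP vP].
- by rewrite sym_lie_in liexx (lin0 (@sym_in_linear _ L)).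
- exact: sym_lieCr.
- by rewrite sym_lieDr !sym_lieDl uP vP (sym_lie_antisym v); ring.
- by rewrite sym_lieMr !sym_leibniz uP vP (sym_lie_antisym v); ring.
Qed.

Let J u v w :=
  sym_lie u (sym_lie v w) + sym_lie v (sym_lie w u) + sym_lie w (sym_lie u v).

Let J_step v w : (forall a, J (sym_in a) v w = 0) -> forall u, J u v w = 0.
Proof.
move=> JL; elim/sym_ind=> [//|c|u u' uP uP'|u u' uP uP']; rewrite /J.
- rewrite !(sym_lieCl, sym_lieCr).
  by rewrite !(lin0 (sym_lie_linr _)) !addr0.
- rewrite !(sym_lieDl, sym_lieDr).
  transitivity (J u v w + J u' v w); first by rewrite /J; ring.
  by rewrite uP uP' addr0.
- rewrite !(sym_leibniz, sym_lieMr, sym_lieDr).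
  transitivity (u * J u' v w + u' * J u v w).
    rewrite /J (sym_lie_antisym v u) (sym_lie_antisym v u').
    by rewrite (sym_lie_antisym w u) (sym_lie_antisym w u'); ring.
  by rewrite uP uP' !mulr0 addr0.
Qed.

Lemma sym_jacobi u v w :
  sym_lie u (sym_lie v w) + sym_lie v (sym_lie w u) + sym_lie w (sym_lie u v)
    = 0.
Proof.
have JC x y z : J x y z = J y z x by rewrite /J -addrA addrC.
rewrite -/(J u v w); move: u; apply: J_step => a.
rewrite JC; move: v; apply: J_step => b.
rewrite JC; move: w; apply: J_step => c; rewrite /J !sym_lie_in.
by rewrite -!(linD (@sym_in_linear _ L)) jacobi (lin0 (@sym_in_linear _ L)).
Qed.

HB.instance Definition _ := Lmodule_isLie.Build K (symalg L)
  sym_lie_linl sym_lie_linr sym_liexx sym_jacobi.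
HB.instance Definition _ := Lie_isPoisson.Build K (symalg L) sym_leibniz.

Lemma lie_sym_in a b : lie (sym_in a) (sym_in b) = sym_in (lie a b).
Proof. exact: sym_lie_in. Qed.

End SymPoisson.

Notation freePoisson K := (symalg (freeLie K nat)).

Definition pvar (K : fieldType) (i : nat) : freePoisson K :=
  sym_in (freeLie_var K i).

Section PoissonTheory.
Variables (K : fieldType) (A : poissonAlgType K).

Lemma lie_algl (a : K) (u : A) : lie a%:A u = 0.
Proof.
suff l1 : lie 1 u = 0 by rewrite lieZl l1 scaler0.
have := leibniz 1 1 u; rewrite !mul1r => /eqP.
by rewrite -subr_eq0 opprD addNKr oppr_eq0 => /eqP.
Qed.

Lemma leibnizr (u v w : A) : lie u (v * w) = v * lie u w + w * lie u v.
Proof.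
by rewrite lie_antisym leibniz opprD -!mulrN -!(lie_antisym u).
Qed.

End PoissonTheory.

Section FreePoissonUniversal.
Variables (K : fieldType) (A : poissonAlgType K).

Lemma poisson_morphism_comp (B C : poissonAlgType K) (g : B -> C) (h : A -> B) :
  poisson_morphism g -> poisson_morphism h -> poisson_morphism (g \o h).
Proof.
move=> [gl [g1 gM] gL] [hl [h1 hM] hL]; split.
- by move=> a u v /=; rewrite hl gl.
- by split=> [|u v] /=; rewrite ?h1 ?hM ?gM.
- by move=> u v /=; rewrite hL gL.
Qed.

Definition freePoisson_lift (x : nat -> A) : freePoisson K -> A :=
  sym_lift (freeLie_lift x).

Lemma freePoisson_lift_var (x : nat -> A) i :
  freePoisson_lift x (pvar K i) = x i.
Proof.
rewrite /freePoisson_lift sym_lift_in ?freeLie_lift_var//.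
by case: (freeLie_lift_morphism x).
Qed.

Lemma freePoisson_lift_morphism (x : nat -> A) :
  poisson_morphism (freePoisson_lift x).
Proof.
have [xl xL] := freeLie_lift_morphism x.
pose h := freePoisson_lift x; rewrite -/h.
have hl : linear h := sym_lift_linear xl.
have [h1 hM] : monoid_morphism h := sym_lift_monoid_morphism xl.
have hin a : h (sym_in a) = freeLie_lift x a := sym_lift_in xl a.
have hC k : h k%:A = k%:A by rewrite (linZ hl) h1.
split=> // u v; elim/sym_ind: v => [b|c|v w uv uw|v w uv uw].
- elim/sym_ind: u => [a|c|u v ub vb|u v ub vb].
  + by rewrite lie_sym_in !hin.
  + by rewrite hC !lie_algl (lin0 hl).
  + by rewrite lieDl !(linD hl) lieDl ub vb.
  + by rewrite leibniz (linD hl) !hM leibniz ub vb.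
- by rewrite lie_antisym lie_algl oppr0 hC lie_antisym lie_algl oppr0 (lin0 hl).
- by rewrite lieDr !(linD hl) lieDr uv uw.
- by rewrite leibnizr (linD hl) !hM leibnizr uv uw.
Qed.

Lemma freePoisson_lift_unique (g h : freePoisson K -> A) :
    poisson_morphism g -> poisson_morphism h ->
    (forall i, g (pvar K i) = h (pvar K i)) -> g =1 h.
Proof.
move=> [gl [g1 gM] gL] [hl [h1 hM] hL] gh.
elim/sym_ind=> [a|c|u v gu gv|u v gu gv].
- apply: (@freeLie_lift_unique _ _ _ (g \o @sym_in _ _) (h \o @sym_in _ _)) a.
  + split=> [k a b|a b] /=; first by rewrite sym_in_linear gl.
    by rewrite -lie_sym_in gL.
  + split=> [k a b|a b] /=; first by rewrite sym_in_linear hl.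
    by rewrite -lie_sym_in hL.
  + exact: gh.
- by rewrite (linZ gl) (linZ hl) g1 h1.
- by rewrite (linD gl) (linD hl) gu gv.
- by rewrite gM hM gu gv.
Qed.

End FreePoissonUniversal.

Section Varieties.
Variable K : fieldType.
Local Notation F := (freePoisson K).

Definition satisfies (A : poissonAlgType K) (f : F) : Prop :=
  forall h : freePoisson K -> A, poisson_morphism h -> h f = 0.

Definition variety (I : set F) : poissonAlgType K -> Prop :=
  fun A => forall f, I f -> satisfies A f.

Definition identities (W : poissonAlgType K -> Prop) : set F :=
  [set f | forall A, W A -> satisfies A f].

End Varieties.

Section RelativelyFree.
Variables (K : fieldType) (W : poissonAlgType K -> Prop).
Local Notation F := (freePoisson K).
Local Notation Id := (identities W).
Implicit Types (f g h : F) (a : K).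

Lemma identities0 : Id 0.
Proof. by move=> A _ h [hl _ _]; rewrite (lin0 hl). Qed.
Lemma identitiesD f g : Id f -> Id g -> Id (f + g).
Proof.
by move=> If Ig A WA h hP; have [hl _ _] := hP; rewrite (linD hl) If ?Ig ?addr0.
Qed.
Lemma identitiesZ a f : Id f -> Id (a *: f).
Proof.
by move=> If A WA h hP; have [hl _ _] := hP; rewrite (linZ hl) If ?scaler0.
Qed.
Lemma identitiesN f : Id f -> Id (- f).
Proof. by move=> If; rewrite -scaleN1r; apply: identitiesZ. Qed.
Lemma identitiesM f g : Id f -> Id (f * g).
Proof.
by move=> If A WA h hP; have [_ [_ hM] _] := hP; rewrite hM If ?mul0r.
Qed.
Lemma identitiesL f g : Id f -> Id (lie f g).
Proof.
by move=> If A WA h hP; have [_ _ hL] := hP; rewrite hL If ?lie0l.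
Qed.

Definition identities_eq : rel F := fun f g => `[< Id (f - g) >].

Lemma identities_eq_equiv : equiv_class_of identities_eq.
Proof.
split=> [f|f g|g f h].
- by apply/asboolP; rewrite subrr; apply: identities0.
- by apply/asboolP/asboolP => /identitiesN; rewrite opprB.
- move=> /asboolP fg /asboolP gh; apply/asboolP.
  by rewrite -[f - h](subrKA g); apply: identitiesD.
Qed.

Canonical identities_equiv_rel := EquivRelPack identities_eq_equiv.

(* F(W, X) = F(X) / Id(W); the epimorphism phi is relfree_pi. *)
Definition relfree := {eq_quot identities_eq}.

HB.instance Definition _ := Choice.on relfree.

Definition relfree_pi f : relfree := \pi_({eq_quot identities_eq}) f.
Definition relfree_repr (u : relfree) : F := repr u.

Lemma relfree_eqP f g : relfree_pi f = relfree_pi g <-> Id (f - g).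
Proof.
exact: iff_trans (rwP (eqmodP identities_equiv_rel f g))
                 (iff_sym (rwP (asboolP _))).
Qed.

Lemma relfree_reprK u : relfree_pi (relfree_repr u) = u.
Proof. exact: reprK. Qed.

Lemma relfree_reprP f : Id (relfree_repr (relfree_pi f) - f).
Proof. by apply/relfree_eqP; rewrite relfree_reprK. Qed.

Lemma relfreeW (P : relfree -> Prop) :
  (forall f, P (relfree_pi f)) -> forall u, P u.
Proof. by move=> Pf; elim/quotW. Qed.

Definition relfree_opp (u : relfree) := relfree_pi (- relfree_repr u).
Definition relfree_add (u v : relfree) :=
  relfree_pi (relfree_repr u + relfree_repr v).
Definition relfree_scale a (u : relfree) := relfree_pi (a *: relfree_repr u).
Definition relfree_mul (u v : relfree) :=
  relfree_pi (relfree_repr u * relfree_repr v).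
Definition relfree_lie (u v : relfree) :=
  relfree_pi (lie (relfree_repr u) (relfree_repr v)).

Lemma relfree_oppE f : relfree_opp (relfree_pi f) = relfree_pi (- f).
Proof.
by apply/relfree_eqP; rewrite -opprD; apply/identitiesN/relfree_reprP.
Qed.
Lemma relfree_addE f g :
  relfree_add (relfree_pi f) (relfree_pi g) = relfree_pi (f + g).
Proof.
apply/relfree_eqP; rewrite opprD addrACA.
by apply: identitiesD; apply: relfree_reprP.
Qed.
Lemma relfree_scaleE a f : relfree_scale a (relfree_pi f) = relfree_pi (a *: f).
Proof.
by apply/relfree_eqP; rewrite -scalerBr; apply/identitiesZ/relfree_reprP.
Qed.
Lemma relfree_mulE f g :
  relfree_mul (relfree_pi f) (relfree_pi g) = relfree_pi (f * g).
Proof.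
apply/relfree_eqP; set f' := relfree_repr _; set g' := relfree_repr _.
have -> : f' * g' - f * g = (f' - f) * g' + (g' - g) * f by ring.
by apply: identitiesD; apply/identitiesM/relfree_reprP.
Qed.
Lemma relfree_lieE f g :
  relfree_lie (relfree_pi f) (relfree_pi g) = relfree_pi (lie f g).
Proof.
apply/relfree_eqP; set f' := relfree_repr _; set g' := relfree_repr _.
have -> : lie f' g' - lie f g = lie (f' - f) g' - lie (g' - g) f.
  rewrite (linB (linear_liel g')) (linB (linear_liel f)) /=.
  by rewrite (lie_antisym g' f) (lie_antisym g f); ring.
apply: identitiesD; last apply: identitiesN.
  by apply/identitiesL/relfree_reprP.
by apply/identitiesL/relfree_reprP.
Qed.

Let E := (relfree_oppE, relfree_addE, relfree_scaleE, relfree_mulE,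
          relfree_lieE).

Lemma relfree_addA : associative relfree_add.
Proof. by do 3![elim/relfreeW=> ?]; rewrite !E addrA. Qed.
Lemma relfree_addC : commutative relfree_add.
Proof. by do 2![elim/relfreeW=> ?]; rewrite !E addrC. Qed.
Lemma relfree_add0 : left_id (relfree_pi 0) relfree_add.
Proof. by elim/relfreeW=> ?; rewrite !E add0r. Qed.
Lemma relfree_addN : left_inverse (relfree_pi 0) relfree_opp relfree_add.
Proof. by elim/relfreeW=> ?; rewrite !E addNr. Qed.

HB.instance Definition _ := GRing.isZmodule.Build relfree
  relfree_addA relfree_addC relfree_add0 relfree_addN.

Lemma relfree_piD : {morph relfree_pi : f g / f + g}.
Proof. by move=> f g; rewrite [RHS]E. Qed.

Lemma relfree_scaleA a b u :
  relfree_scale a (relfree_scale b u) = relfree_scale (a * b) u.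
Proof. by elim/relfreeW: u => ?; rewrite !E scalerA. Qed.
Lemma relfree_scale1 : left_id 1 relfree_scale.
Proof. by elim/relfreeW=> ?; rewrite !E scale1r. Qed.
Lemma relfree_scaleDr : right_distributive relfree_scale +%R.
Proof.
move=> a; do 2![elim/relfreeW=> ?].
by rewrite -relfree_piD !E scalerDr relfree_piD.
Qed.
Lemma relfree_scaleDl u : {morph relfree_scale^~ u : a b / a + b}.
Proof.
by move=> a b; elim/relfreeW: u => ?; rewrite !E scalerDl relfree_piD.
Qed.

HB.instance Definition _ := GRing.Zmodule_isLmodule.Build K relfree
  relfree_scaleA relfree_scale1 relfree_scaleDr relfree_scaleDl.

Lemma relfree_piZ a f : relfree_pi (a *: f) = a *: relfree_pi f.
Proof. by rewrite [RHS]E. Qed.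

Lemma relfree_pi_linear : linear relfree_pi.
Proof. by move=> a f g; rewrite relfree_piD relfree_piZ. Qed.

Lemma relfree_linl v : linear (relfree_lie^~ v).
Proof.
move=> a; elim/relfreeW=> f; elim/relfreeW=> g; elim/relfreeW: v => h.
by rewrite -relfree_pi_linear !E linear_liel relfree_pi_linear.
Qed.
Lemma relfree_linr u : linear (relfree_lie u).
Proof.
move=> a; elim/relfreeW=> f; elim/relfreeW=> g; elim/relfreeW: u => h.
by rewrite -relfree_pi_linear !E linear_lier relfree_pi_linear.
Qed.
Lemma relfree_liexx u : relfree_lie u u = 0.
Proof. by elim/relfreeW: u => f; rewrite E liexx. Qed.
Lemma relfree_jacobi u v w :
  relfree_lie u (relfree_lie v w) + relfree_lie v (relfree_lie w u)
    + relfree_lie w (relfree_lie u v) = 0.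
Proof.
elim/relfreeW: u => f; elim/relfreeW: v => g; elim/relfreeW: w => h.
by rewrite !E -!relfree_piD jacobi.
Qed.

HB.instance Definition _ := Lmodule_isLie.Build K relfree
  relfree_linl relfree_linr relfree_liexx relfree_jacobi.

Lemma relfree_mulA : associative relfree_mul.
Proof. by do 3![elim/relfreeW=> ?]; rewrite !E mulrA. Qed.
Lemma relfree_mulC : commutative relfree_mul.
Proof. by do 2![elim/relfreeW=> ?]; rewrite !E mulrC. Qed.
Lemma relfree_mul1 : left_id (relfree_pi 1) relfree_mul.
Proof. by elim/relfreeW=> ?; rewrite !E mul1r. Qed.
Lemma relfree_mulDl : left_distributive relfree_mul +%R.
Proof.
by do 3![elim/relfreeW=> ?]; rewrite -relfree_piD !E mulrDl relfree_piD.
Qed.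

HB.instance Definition _ := GRing.Zmodule_isComPzRing.Build relfree
  relfree_mulA relfree_mulC relfree_mul1 relfree_mulDl.

Lemma relfree_piM : {morph relfree_pi : f g / f * g}.
Proof. by move=> f g; rewrite [RHS]E. Qed.
Lemma relfree_piL : {morph relfree_pi : f g / lie f g}.
Proof. by move=> f g; rewrite [RHS]E. Qed.

End RelativelyFree.

(* If W is nonempty, F(W, X) is a Poisson algebra; it is free in W. *)
Section RelativelyFreePoisson.
Variables (K : fieldType) (W : poissonAlgType K -> Prop).
Hypothesis W_nonempty : exists A, W A.

Definition relfreeP of (exists A, W A) := relfree W.
Local Notation FW := (relfreeP W_nonempty).

HB.instance Definition _ := GRing.ComPzRing.on FW.
HB.instance Definition _ := LieAlgebra.on FW.

Lemma relfree_oner_neq0 : 1 != 0 :> FW.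
Proof.
have [A WA] := W_nonempty.
apply/eqP => /relfree_eqP/(_ A WA _ (freePoisson_lift_morphism (fun=> 0))).
rewrite subr0; have [_ [-> _] _] := freePoisson_lift_morphism (fun=> 0 : A).
by apply/eqP; rewrite oner_eq0.
Qed.

HB.instance Definition _ := GRing.PzSemiRing_isNonZero.Build FW
  relfree_oner_neq0.

Lemma relfree_scaleAl a (u v : FW) : a *: (u * v) = (a *: u) * v.
Proof.
elim/relfreeW: u => f; elim/relfreeW: v => g.
by rewrite -relfree_piM -!relfree_piZ -relfree_piM scalerAl.
Qed.

HB.instance Definition _ := GRing.Lmodule_isLalgebra.Build K FW
  relfree_scaleAl.
HB.instance Definition _ := GRing.Lalgebra_isComAlgebra.Build K FW.

Lemma relfree_leibniz (u v w : FW) :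
  lie (u * v) w = u * lie v w + v * lie u w.
Proof.
elim/relfreeW: u => f; elim/relfreeW: v => g; elim/relfreeW: w => h.
by rewrite -relfree_piM -!relfree_piL -!relfree_piM -relfree_piD leibniz.
Qed.

HB.instance Definition _ := Lie_isPoisson.Build K FW relfree_leibniz.

Lemma relfree_pi_morphism : poisson_morphism (relfree_pi W : _ -> FW).
Proof.
split; first exact: relfree_pi_linear.
  by split=> // f g; apply: relfree_piM.
exact: relfree_piL.
Qed.

Lemma relfree_lift (A : poissonAlgType K) (x : nat -> A) : W A ->
  exists h : FW -> A, poisson_morphism h /\
    (forall i, h (relfree_pi W (pvar K i)) = x i).
Proof.
move=> WA; have gP := freePoisson_lift_morphism x.
pose g := freePoisson_lift x; have [gl [g1 gM] gL] := gP.
pose h (u : FW) := g (relfree_repr u).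
have hE f : h (relfree_pi W f) = g f.
  have := @relfree_reprP _ W f A WA _ gP; rewrite (linB gl) => /eqP.
  by rewrite subr_eq0 => /eqP.
exists h; split; last by move=> i; rewrite hE; apply: freePoisson_lift_var.
split.
- move=> a; elim/relfreeW=> f; elim/relfreeW=> f'.
  by rewrite -relfree_pi_linear !hE; apply: gl.
- split; first by rewrite [LHS]hE.
  by elim/relfreeW=> f; elim/relfreeW=> f'; rewrite -relfree_piM !hE; apply: gM.
- by elim/relfreeW=> f; elim/relfreeW=> f'; rewrite -relfree_piL !hE; apply: gL.
Qed.

Lemma relfree_unique (A : poissonAlgType K) (g h : FW -> A) :
    poisson_morphism g -> poisson_morphism h ->
    (forall i, g (relfree_pi W (pvar K i)) = h (relfree_pi W (pvar K i))) ->
  g =1 h.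
Proof.
move=> gP hP gh; elim/relfreeW=> f.
have piP := relfree_pi_morphism.
exact: (freePoisson_lift_unique (poisson_morphism_comp gP piP)
                                (poisson_morphism_comp hP piP)).
Qed.

End RelativelyFreePoisson.

Lemma relfree_variety (K : fieldType) (I : set (freePoisson K))
  (VI : exists A, variety I A) : variety I (relfreeP VI).
Proof.
move=> f If h hP.
pose e : freePoisson K -> freePoisson K :=
  freePoisson_lift (fun i => relfree_repr (h (pvar K i))).
have eP : poisson_morphism e := freePoisson_lift_morphism _.
have piP := relfree_pi_morphism VI.
have -> : h f = relfree_pi (variety I) (e f).
  apply: (freePoisson_lift_unique hP (poisson_morphism_comp piP eP)) => i /=.
  by rewrite /e freePoisson_lift_var [RHS]relfree_reprK.
apply/relfree_eqP; rewrite subr0 => A WA g gP.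
exact: (WA f If _ (poisson_morphism_comp gP eP)).
Qed.

Section Dimension.
Variables (K : fieldType) (V : lmodType K).

Definition lin_span (S : set V) : set V :=
  [set v | exists n (b : 'I_n -> V) (c : 'I_n -> K),
     (forall i, S (b i)) /\ v = \sum_i c i *: b i].

Definition lin_free n (b : 'I_n -> V) : Prop :=
  forall c : 'I_n -> K, \sum_i c i *: b i = 0 -> forall i, c i = 0.

Definition is_dim (S : set V) (n : nat) : Prop :=
  exists b : 'I_n -> V, [/\ forall i, S (b i), lin_free b &
    S `<=` lin_span (range b)].

Lemma lin_span_ord n (b : 'I_n -> V) v : lin_span (range b) v ->
  exists c : 'I_n -> K, v = \sum_i c i *: b i.
Proof.
move=> [m [b' [c [b'b ->]]]].
have /choice[j jP] : forall i, exists j, b j = b' i.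
  by move=> i; have [j _ <-] := b'b i; exists j.
exists (fun k => \sum_(i | j i == k) c i).
rewrite (partition_big j xpredT)//=; apply: eq_bigr => k _.
by rewrite scaler_suml; apply: eq_bigr => i /eqP <-; rewrite jP.
Qed.

Lemma lin_free_leq m n (b : 'I_m -> V) (b' : 'I_n -> V) :
  lin_free b -> range b `<=` lin_span (range b') -> (m <= n)%N.
Proof.
move=> bf bb'.
have /choice[C CP] : forall i, exists c : 'I_n -> K, b i = \sum_j c j *: b' j.
  by move=> i; apply/lin_span_ord/bb'; exists i.
pose M := \matrix_(i < m, j < n) C i j.
suff /eqP <- : row_free M by apply: rank_leq_col.
apply/inj_row_free => v vM; apply/rowP => i; rewrite mxE.
apply: (bf (v 0)); transitivity (\sum_j (v *m M) 0 j *: b' j).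
  under eq_bigr => k _ do rewrite CP scaler_sumr.
  rewrite exchange_big/=; apply: eq_bigr => j _.
  rewrite mxE scaler_suml; apply: eq_bigr => k _.
  by rewrite mxE scalerA.
by rewrite vM big1// => j _; rewrite mxE scale0r.
Qed.

Lemma is_dim_unique S m n : is_dim S m -> is_dim S n -> m = n.
Proof.
move=> [b [Sb bf Sbb]] [b' [Sb' bf' Sbb']]; apply/eqP; rewrite eqn_leq.
apply/andP; split.
  by apply: (lin_free_leq bf) => _ [i _ <-]; apply: Sbb'.
by apply: (lin_free_leq bf') => _ [i _ <-]; apply: Sbb.
Qed.

(* The value for infinite-dimensional subspaces is irrelevant. *)
Definition dim (S : set V) : nat := xget 0%N [set n | is_dim S n].

End Dimension.

Inductive lie_comm : Type :=
| Comm1 of nat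
| Comm2 of lie_comm & lie_comm.

Fixpoint comm_vars (t : lie_comm) : seq nat :=
  match t with
  | Comm1 i => [:: i]
  | Comm2 t u => comm_vars t ++ comm_vars u
  end.

Section Codimension.
Variable K : fieldType.
Local Notation F := (freePoisson K).

Fixpoint comm_val (t : lie_comm) : F :=
  match t with
  | Comm1 i => pvar K i
  | Comm2 t u => lie (comm_val t) (comm_val u)
  end.

Definition multilinear_monomial (n : nat) : set F :=
  [set f | exists ts : seq lie_comm,
     perm_eq (flatten (map comm_vars ts)) (iota 1 n) /\
     f = \prod_(t <- ts) comm_val t].

Definition P_ n : set F := lin_span (multilinear_monomial n).

Definition codim (W : poissonAlgType K -> Prop) n : nat :=
  dim (relfree_pi W @` P_ n).

Definition W_ (s : nat) : poissonAlgType K -> Prop :=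
  variety [set \prod_(1 <= i < s.+1)
                 lie (pvar K (2 * i - 1)) (pvar K (2 * i))].

End Codimension.

(* Formal power series in z; the wrapper keeps the Cauchy product apart from
   the pointwise structures on functions. *)
Record fps (R : Type) := Fps { fps_coef : nat -> R }.

Section FpsRing.
Variable R : comNzRingType.
Implicit Types (f g h : fps R) (p q : {poly R}).

HB.instance Definition _ := gen_eqMixin (fps R).
HB.instance Definition _ := gen_choiceMixin (fps R).

Lemma fps_eqP f g : (forall n, fps_coef f n = fps_coef g n) -> f = g.
Proof. by case: f g => f [g] /= fg; congr Fps; apply/funext. Qed.

Definition fps_add f g := Fps (fun n => fps_coef f n + fps_coef g n).
Definition fps_opp f := Fps (fun n => - fps_coef f n).
Definition fps_mul f g :=
  Fps (fun n => \sum_(i < n.+1) fps_coef f i * fps_coef g (n - i)).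
Definition fps_const (a : R) := Fps (fun n => if n is 0 then a else 0).
Definition fps_scale a f := Fps (fun n => a * fps_coef f n).

Lemma fps_addA : associative fps_add.
Proof. by move=> f g h; apply: fps_eqP => n /=; rewrite addrA. Qed.
Lemma fps_addC : commutative fps_add.
Proof. by move=> f g; apply: fps_eqP => n /=; rewrite addrC. Qed.
Lemma fps_add0 : left_id (fps_const 0) fps_add.
Proof. by move=> f; apply: fps_eqP => -[|n] /=; rewrite add0r. Qed.
Lemma fps_addN : left_inverse (fps_const 0) fps_opp fps_add.
Proof. by move=> f; apply: fps_eqP => -[|n] /=; rewrite addNr. Qed.

HB.instance Definition _ := GRing.isZmodule.Build (fps R)
  fps_addA fps_addC fps_add0 fps_addN.

Let approx n f p := forall i, (i <= n)%N -> p`_i = fps_coef f i.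

Let trunc n f : {poly R} := \poly_(i < n.+1) fps_coef f i.

Let approx_trunc n f : approx n f (trunc n f).
Proof. by move=> i ni; rewrite coef_poly ltnS ni. Qed.

Let approxM n f g p q :
  approx n f p -> approx n g q -> approx n (fps_mul f g) (p * q).
Proof.
move=> fp gq i ni; rewrite coefM /=; apply: eq_bigr => j _.
by rewrite fp ?gq// (leq_trans _ ni)// ?leq_subr// -ltnS.
Qed.

Lemma fps_mulA : associative fps_mul.
Proof.
move=> f g h; apply: fps_eqP => n.
have T k := @approx_trunc n k.
rewrite -(approxM (T f) (approxM (T g) (T h)) (leqnn n)).
by rewrite -(approxM (approxM (T f) (T g)) (T h) (leqnn n)) mulrA.
Qed.
Lemma fps_mulC : commutative fps_mul.
Proof.
move=> f g; apply: fps_eqP => n; have T k := @approx_trunc n k.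
by rewrite -(approxM (T f) (T g) (leqnn n)) mulrC (approxM (T g) (T f)).
Qed.
Lemma fps_mul1 : left_id (fps_const 1) fps_mul.
Proof.
move=> f; apply: fps_eqP => n /=.
by rewrite big_ord_recl big1 ?addr0 ?mul1r ?subn0// => i _; rewrite mul0r.
Qed.
Lemma fps_mulDl : left_distributive fps_mul +%R.
Proof.
move=> f g h; apply: fps_eqP => n /=; rewrite -big_split /=.
by apply: eq_bigr => i _; rewrite mulrDl.
Qed.
Lemma fps_oner_neq0 : fps_const 1 != 0.
Proof.
apply/eqP => /(congr1 (fun f => fps_coef f 0)) /= /eqP.
by rewrite oner_eq0.
Qed.

HB.instance Definition _ := GRing.Zmodule_isComNzRing.Build (fps R)
  fps_mulA fps_mulC fps_mul1 fps_mulDl fps_oner_neq0.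

Lemma fps_scaleA a b f : fps_scale a (fps_scale b f) = fps_scale (a * b) f.
Proof. by apply: fps_eqP => n /=; rewrite mulrA. Qed.
Lemma fps_scale1 : left_id 1 fps_scale.
Proof. by move=> f; apply: fps_eqP => n /=; rewrite mul1r. Qed.
Lemma fps_scaleDr : right_distributive fps_scale +%R.
Proof. by move=> a f g; apply: fps_eqP => n /=; rewrite mulrDr. Qed.
Lemma fps_scaleDl f : {morph fps_scale^~ f : a b / a + b}.
Proof. by move=> a b; apply: fps_eqP => n /=; rewrite mulrDl. Qed.

HB.instance Definition _ := GRing.Zmodule_isLmodule.Build R (fps R)
  fps_scaleA fps_scale1 fps_scaleDr fps_scaleDl.

Lemma fps_scaleAl a f g : a *: (f * g) = (a *: f) * g.
Proof.
apply: fps_eqP => n /=; rewrite mulr_sumr.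
by apply: eq_bigr => i _; rewrite mulrA.
Qed.

HB.instance Definition _ := GRing.Lmodule_isLalgebra.Build R (fps R)
  fps_scaleAl.
HB.instance Definition _ := GRing.Lalgebra_isComAlgebra.Build R (fps R).

Definition fps_unit : {pred fps R} := fun f => `[< exists g, g * f = 1 >].
Definition fps_inv f : fps R := xget f [set g | g * f = 1].

Lemma fps_mulVf : {in fps_unit, left_inverse 1 fps_inv *%R}.
Proof.
by move=> f /asboolP[g gf]; rewrite /fps_inv; case: xgetP => // /(_ g).
Qed.
Lemma fps_unitP f g : g * f = 1 -> fps_unit f.
Proof. by move=> gf; apply/asboolP; exists g. Qed.
Lemma fps_inv_out : {in [predC fps_unit], fps_inv =1 id}.
Proof.
move=> f /asboolP nf; rewrite /fps_inv; case: xgetP => // g _ gf.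
by case: nf; exists g.
Qed.

HB.instance Definition _ := GRing.ComNzRing_hasMulInverse.Build (fps R)
  fps_mulVf fps_unitP fps_inv_out.

Definition fps_z : fps R := Fps (fun n => (n == 1%N)%:R).

Lemma fps_inv1Bz : (1 - fps_z)^-1 = Fps (fun _ => 1).
Proof.
suff e : Fps (fun _ => 1) * (1 - fps_z) = 1.
  have u : 1 - fps_z \is a GRing.unit by apply: fps_unitP e.
  by apply: (mulIr u); rewrite e mulVr.
apply: fps_eqP => n; rewrite [LHS]/= big_ord_recr /=.
rewrite subnn mul1r subr0; case: n => [|n]; first by rewrite big_ord0 add0r.
rewrite big_ord_recr /= subSnn big1 => [|i _].
  by rewrite /= mul1r add0r sub0r addNr.
rewrite mul1r subSn; last by rewrite ltnW.
by rewrite -(subnSK (ltn_ord i)) /= subr0.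
Qed.

(* \sum_(s <= k < oo) f k = S: the coefficients of the partial sums are
   eventually constant. *)
Definition fps_sums (s : nat) (f : nat -> fps R) (S : fps R) : Prop :=
  forall n, exists M, forall m, (M <= m)%N ->
    fps_coef (\sum_(s <= k < m) f k) n = fps_coef S n.

End FpsRing.

Definition fps_exp : fps rat := Fps (fun n => (n`!%:R)^-1).

(* \sum_(n >= m) z^n / n *)
Definition fps_harmonic (m : nat) : fps rat :=
  Fps (fun n => if (n < m)%N then 0 else n%:R^-1).

(* - ln (1 - z) *)
Definition fps_mln1Bz : fps rat := fps_harmonic 1.

Definition complexity (K : fieldType) (W : poissonAlgType K -> Prop) :
  fps rat :=
  Fps (fun n => (codim W n)%:R / n`!%:R).

(* Main.v *)
From HB Require Import structures.
From mathcomp Require Import all_boot all_order all_algebra fingroup perm.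
From mathcomp Require Import generic_quotient boolp classical_sets ring zify.
Require Import Defs.

(** In an algebra of W_s all products of s brackets vanish. Modulo the
    identities, P_n is therefore spanned by products of commutators of which
    fewer than s have length at least 2. By the Jacobi identity a commutator is a
    combination of left-normed ones [x_i, x_j, ..., x_k] in the same variables
    that begin with the least variable x_i, and such a word is the same thing as
    a cycle (i j ... k). So the spanning products are indexed by permutations
    written as products of disjoint cycles ([P_span_cycle_prod]), and those with
    fewer than s nontrivial cycles suffice ([cycle_prod_eq0]).

    These products are linearly independent over any field. Fix a permutation t
    and evaluate x_j at the matrix unit E_(j, t j), plus the scalar 1 if t fixes
    j, in the symmetric algebra of gl_n. A product of such matrix units is
    nonzero only along a word that follows t, and the diagonal entries at the
    least elements of the nontrivial cycles of t take the value 1 on the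
    left-normed commutators of these cycles and 0 on all other ones of length
    at least 2 ([cycle_trace_lnorm]). The multiplicative extension of this functional
    separates t from all other permutations ([gauge_cycle_prod]). If it is made
    to take values in K[X], with matrices in degree 1, it sends products of s
    brackets to multiples of X^s; so the separation survives in the quotient by
    the ideal spanned by the multiples of products of s brackets, as soon as t
    has fewer than s nontrivial cycles. That ideal is closed under the bracket
    ([bracket_ideal_lie]) and the quotient belongs to W_s. Consequently c_n(W_s)
    is the number of permutations of n points with fewer than s nontrivial
    cycles ([codimE]).

    It remains to see that exp(z) H^k/k!, with H the sum of z^n/n for n >= 2, is
    the exponential generating function of the permutations with k nontrivial
    cycles ([count_cycles]). A permutation of m + 1 points arises in exactly one
    way from one of m points, either by adding a fixed point or by inserting the
    new point into a cycle next to an old point; the latter creates a nontrivial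
    cycle if and only if the old point was fixed. The resulting recursion
    in the numbers of nontrivial cycles and of fixed points ([count_fixedS]) is
    the one satisfied by the coefficients, because (1 - z) z H' = z^2. Formula
    (1) is the sum over k < s; formula (2) follows since the sum over all k
    counts all n! permutations of n points, for each n. *)

Set Implicit Arguments.
Unset Strict Implicit.
Unset Printing Implicit Defensive.

Import GRing.Theory.
Local Open Scope ring_scope.

(** * Linear spans *)

Section LinearSpan.
Variables (K : fieldType) (V : lmodType K).
Implicit Types (S : set V) (u v : V).

Lemma lin_span_mem S v : S v -> lin_span S v.
Proof.
by move=> Sv; exists 1, (fun=> v), (fun=> 1); rewrite big_ord1 scale1r.
Qed.

Lemma lin_span0 S : lin_span S 0.
Proof. by exists 0, (fun=> 0), (fun=> 0); split=> [[]//|]; rewrite big_ord0. Qed.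

Lemma lin_spanD S u v : lin_span S u -> lin_span S v -> lin_span S (u + v).
Proof.
move=> [m [b [c [Sb ->]]]] [n [b' [c' [Sb' ->]]]].
pose glue T (f : 'I_m -> T) (g : 'I_n -> T) (i : 'I_(m + n)) :=
  match split i with inl j => f j | inr k => g k end.
exists (m + n)%N, (glue _ b b'), (glue _ c c'); split.
  by move=> i; rewrite /glue; case: split.
rewrite big_split_ord /=; congr (_ + _); apply: eq_bigr => i _.
  by rewrite /glue -/(unsplit (inl i)) unsplitK.
by rewrite /glue -/(unsplit (inr i)) unsplitK.
Qed.

Lemma lin_spanZ S a v : lin_span S v -> lin_span S (a *: v).
Proof.
move=> [n [b [c [Sb ->]]]]; exists n, b, (fun i => a * c i); split=> //.
by rewrite scaler_sumr; apply: eq_bigr => i _; rewrite scalerA.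
Qed.

Lemma lin_spanN S v : lin_span S v -> lin_span S (- v).
Proof. by rewrite -scaleN1r; apply: lin_spanZ. Qed.

End LinearSpan.

Lemma lin_span_image (K : fieldType) (V V' : lmodType K) (f : V -> V')
    (S : set V) (S' : set V') : linear f ->
    (forall v, S v -> lin_span S' (f v)) ->
  forall v, lin_span S v -> lin_span S' (f v).
Proof.
move=> fl SS' _ [n [b [c [Sb ->]]]].
elim: n b c Sb => [|n IHn] b c Sb.
  by rewrite big_ord0 (lin0 fl); apply: lin_span0.
rewrite big_ord_recl (linD fl) (linZ fl); apply: lin_spanD.
  by apply/lin_spanZ/SS'.
by apply: IHn => i; apply: Sb.
Qed.

Lemma lin_span_ker (K : fieldType) (V V' : lmodType K) (f : V -> V')
    (S : set V) : linear f -> (forall v, S v -> f v = 0) ->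
  forall v, lin_span S v -> f v = 0.
Proof.
move=> fl S0 v Sv.
have [|n [b [c [Sb ->]]]] := @lin_span_image _ _ _ f S set0 fl _ v Sv.
  by move=> u /S0 ->; apply: lin_span0.
by rewrite big1// => i _; case: (Sb i).
Qed.

(** * Left-normed commutators *)

Section LeftNormed.
Variables (K : fieldType) (T : Type).

Definition lnorm (L : lieAlgType K) (x : T -> L) (b : seq T) : L :=
  if b is i :: s then foldl (fun a j => lie a (x j)) (x i) s else 0.

Lemma lnorm_rcons (L : lieAlgType K) (x : T -> L) b j : b <> [::] ->
  lnorm x (rcons b j) = lie (lnorm x b) (x j).
Proof. by case: b => // i s _; rewrite /lnorm /= -cats1 foldl_cat. Qed.

Lemma lnorm_morph (L M : lieAlgType K) (h : L -> M) (x : T -> L) b :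
  b <> [::] -> {morph h : u v / lie u v} -> h (lnorm x b) = lnorm (h \o x) b.
Proof.
case: b => // i s _ hL; rewrite /lnorm /=.
by elim: s (x i) => //= j s IHs a; rewrite IHs hL.
Qed.

End LeftNormed.

Lemma lnorm_map (K : fieldType) (S T : Type) (f : S -> T) (L : lieAlgType K)
  (x : T -> L) b : lnorm x (map f b) = lnorm (x \o f) b.
Proof. by case: b => //= i s; elim: s (x (f i)) => //=. Qed.

Section LeftNormedSpan.
Variable K : fieldType.
Local Notation x := (pvar K).

(** Jacobi's identity [a, [y, z]] = [[a, y], z] - [[a, z], y] moves the brackets
    of the right argument to the left, one at a time. *)
Lemma lie_lnorm_span t b : b <> [::] ->
  lin_span [set f | exists2 s, perm_eq s (comm_vars t) & f = lnorm x (b ++ s)]%classic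
    (lie (lnorm x b) (comm_val K t)).
Proof.
elim: t b => [i|t IHt u IHu] b b0 /=.
  apply: lin_span_mem; exists [:: i] => //.
  by rewrite cats1 lnorm_rcons.
have -> : forall a y z : freePoisson K,
    lie a (lie y z) = lie (lie a y) z - lie (lie a z) y.
  move=> a y z; have := jacobi a y z.
  rewrite (lie_antisym z a) (linN (linear_lier y)) -(lie_antisym (lie a z)).
  rewrite (lie_antisym z (lie a y)) -addrA => /eqP.
  by rewrite addr_eq0 opprD opprK addrC => /eqP.
apply: lin_spanD; last apply: lin_spanN.
- apply: (lin_span_image (linear_liel _)) (IHt b b0) => _ [s st ->].
  have bs0 : b ++ s <> [::] by case: (b) b0.
  apply: (@lin_span_image _ _ _ id) (IHu _ bs0) => // _ [s' su ->].
  by apply: lin_span_mem; exists (s ++ s'); rewrite ?catA// perm_cat.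
- apply: (lin_span_image (linear_liel _)) (IHu b b0) => _ [s st ->].
  have bs0 : b ++ s <> [::] by case: (b) b0.
  apply: (@lin_span_image _ _ _ id) (IHt _ bs0) => // _ [s' su ->].
  apply: lin_span_mem; exists (s ++ s'); rewrite ?catA//.
  by rewrite perm_catC perm_cat.
Qed.

(** Antisymmetry brings the factor containing the chosen variable to the left,
    after which the other factor is unfolded by [lie_lnorm_span]. *)
Lemma comm_val_span t i : i \in comm_vars t ->
  lin_span [set f | exists2 s, perm_eq (i :: s) (comm_vars t) &
                               f = lnorm x (i :: s)]%classic
    (comm_val K t).
Proof.
elim: t => [j|t IHt u IHu] /=.
  by rewrite inE => /eqP ->; apply: lin_span_mem; exists [::].
rewrite mem_cat => /orP[/IHt it|/IHu iu].
- apply: (lin_span_image (linear_liel _)) it => _ [s st ->].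
  have is0 : i :: s <> [::] by [].
  apply: (@lin_span_image _ _ _ id) (lie_lnorm_span u is0) => // _ [s' su ->].
  apply: lin_span_mem; exists (s ++ s') => //.
  by rewrite -cat_cons perm_cat.
- rewrite lie_antisym; apply: lin_spanN.
  apply: (lin_span_image (linear_liel _)) iu => _ [s st ->].
  have is0 : i :: s <> [::] by [].
  apply: (@lin_span_image _ _ _ id) (lie_lnorm_span t is0) => // _ [s' su ->].
  apply: lin_span_mem; exists (s ++ s') => //.
  by rewrite -cat_cons perm_catC perm_cat.
Qed.

Definition min_first (b : seq nat) : bool :=
  if b is i :: s then all (leq i) s else false.

Lemma comm_val_min_span t :
  lin_span [set f | exists b, [/\ perm_eq b (comm_vars t), min_first b &
                                  f = lnorm x b]]%classic
    (comm_val K t).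
Proof.
have [i it imin] : exists2 i, i \in comm_vars t & all (leq i) (comm_vars t).
  elim: t => [j|t [i it ti] u [j ju uj]] /=.
    by exists j; rewrite ?inE ?eqxx//= leqnn.
  have [ij|/ltnW ji] := leqP i j.
    exists i; first by rewrite mem_cat it.
    rewrite all_cat ti; apply: sub_all uj => k; exact: leq_trans.
  exists j; first by rewrite mem_cat ju orbT.
  by rewrite all_cat uj andbT; apply: sub_all ti => k; apply: leq_trans.
apply: (@lin_span_image _ _ _ id) (comm_val_span it) => // _ [s st ->].
apply: lin_span_mem; exists (i :: s); split=> //=.
by move: imin; rewrite -(perm_all _ st) /= leqnn.
Qed.

(** Putting the least variable first singles out one left-normed commutator for
    each cyclic order of the variables: this is what makes the products below
    correspond to permutations. *)
Lemma prod_comm_val_span ts :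
  lin_span [set f | exists bs, [/\ perm_eq (flatten bs)
                                     (flatten (map comm_vars ts)),
                                   all min_first bs &
                                   f = \prod_(b <- bs) lnorm x b]]%classic
    (\prod_(t <- ts) comm_val K t).
Proof.
elim: ts => [|t ts IHts].
  by apply: lin_span_mem; exists [::]; rewrite /= !big_nil.
rewrite big_cons.
have lM y : linear ( *%R^~ y : freePoisson K -> freePoisson K).
  by move=> a u v; rewrite mulrDl scalerAl.
apply: (lin_span_image (lM _)) (comm_val_min_span t) => _ [b [bt b1 ->]].
have lM' y : linear ( *%R y : freePoisson K -> freePoisson K).
  by move=> a u v; rewrite mulrDr scalerAr.
apply: (lin_span_image (lM' _)) IHts => _ [bs [bts b1s ->]].
apply: lin_span_mem; exists (b :: bs); split=> /=.
- by rewrite perm_cat.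
- by rewrite b1.
- by rewrite big_cons.
Qed.

End LeftNormedSpan.

(** * Products of commutators indexed by permutations *)

Lemma uniq_flatten_inj (T : eqType) (bs : seq (seq T)) : uniq (flatten bs) ->
  forall b b' j, b \in bs -> b' \in bs -> j \in b -> j \in b' -> b = b'.
Proof.
elim: bs => //= c bs IHbs; rewrite cat_uniq => /and3P[_ /hasPn cbs ubs].
have dis b j : b \in bs -> j \in b -> j \notin c.
  by move=> bbs jb; apply: cbs; apply/flattenP; exists b.
move=> b b' j; rewrite !inE => /predU1P[->|bbs] /predU1P[->|b'bs] // jb jb'.
- by have := dis _ _ b'bs jb'; rewrite jb.
- by have := dis _ _ bbs jb; rewrite jb'.
- exact: IHbs jb jb'.
Qed.

Lemma flatten_map_uniq (S T : eqType) (f : S -> seq T) (s : seq S) : uniq s ->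
    (forall i, uniq (f i)) ->
    {in s &, forall i i' j, j \in f i -> j \in f i' -> i = i'} ->
  uniq (flatten (map f s)).
Proof.
elim: s => //= i s IHs /andP[is_ us] uf finj.
rewrite cat_uniq uf IHs//=; last first.
  by move=> a b sa sb; apply: finj; rewrite inE ?sa ?sb orbT.
rewrite andbT; apply/hasPn => j /flattenP[_ /mapP[i' i's ->] ji'].
apply: contra is_ => ji; suff -> : i = i' by [].
by apply: (finj i i' _ _ j) => //; rewrite inE ?eqxx// i's orbT.
Qed.

Lemma uniq_flatten_map (S T : eqType) (f : S -> seq T) (s : seq S) :
  (forall i, f i <> [::]) -> uniq (flatten (map f s)) -> uniq s.
Proof.
move=> f0; elim: s => //= i s IHs; rewrite cat_uniq => /and3P[_ /hasPn fi us].
rewrite IHs// andbT; apply/negP => is_; move: (f0 i) fi.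
case fiE: (f i) => [//|j b] _ /(_ j); rewrite mem_head => /(_ _)/negP; apply=> //.
by apply/flattenP; exists (f i); [apply: map_f | rewrite fiE mem_head].
Qed.

Section CycleProduct.
Variable n : nat.
Implicit Types (s : 'S_n) (i j : 'I_n) (bs : seq (seq 'I_n)).

(** The least element of each cycle serves as the starting point at which the
    cycle is cut open. *)
Definition orbit_min s : pred 'I_n :=
  fun i => [forall j, (j \in orbit s i) ==> (i <= j)%N].

Lemma orbit_minP s i :
  reflect (forall j, j \in orbit s i -> (i <= j)%N) (orbit_min s i).
Proof. by apply: (iffP forallP) => H j; apply/implyP/H. Qed.

Lemma eq_orbit_mem s i j : j \in orbit s i -> orbit s j =i orbit s i.
Proof.
move=> ji k; rewrite -!fconnect_orbit; apply/esym.
apply: (same_connect (fconnect_sym (@perm_inj _ s))).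
by rewrite fconnect_orbit.
Qed.

Lemma orbit_min_inj s i i' j : orbit_min s i -> orbit_min s i' ->
  j \in orbit s i -> j \in orbit s i' -> i = i'.
Proof.
move=> /orbit_minP mi /orbit_minP mi' ji ji'.
have oo : orbit s i =i orbit s i'.
  by move=> k; rewrite -(eq_orbit_mem ji) (eq_orbit_mem ji').
apply/val_inj/eqP; rewrite eqn_leq mi ?mi' -?oo ?in_orbit//.
by rewrite oo in_orbit.
Qed.

Lemma orbit_min_ex s j : exists2 i, orbit_min s i & j \in orbit s i.
Proof.
case: (@arg_minnP _ j [in orbit s j] val); first exact: in_orbit.
move=> i ij imin; exists i; last by rewrite (eq_orbit_mem ij) in_orbit.
by apply/orbit_minP => k; rewrite (eq_orbit_mem ij) => /imin.
Qed.

Lemma orbits_partition s :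
  perm_eq (flatten [seq orbit s i | i <- enum (orbit_min s)]) (enum 'I_n).
Proof.
apply: uniq_perm; rewrite ?enum_uniq//.
  apply: flatten_map_uniq => [|i|i i']; rewrite ?enum_uniq ?orbit_uniq//.
  by rewrite !mem_enum => mi mi' j; apply: orbit_min_inj mi mi'.
move=> j; rewrite mem_enum; apply/flatten_mapP.
by have [i mi ji] := orbit_min_ex s j; exists i; rewrite ?mem_enum.
Qed.

(** The permutation sends every letter to the cyclically next one in its
    block. *)
Lemma ex_perm_fcycle bs : perm_eq (flatten bs) (enum 'I_n) ->
  exists s, all (fcycle s) bs.
Proof.
move=> bsn; have ubs : uniq (flatten bs) by rewrite (perm_uniq bsn) enum_uniq.
pose blk j := nth [::] bs (find (fun b => j \in b) bs).
have blkP j : blk j \in bs /\ j \in blk j.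
  have : j \in flatten bs by rewrite (perm_mem bsn) mem_enum.
  move=> /flattenP[b bbs jb].
  have hb : has (fun b => j \in b) bs by apply/hasP; exists b.
  by split; [rewrite mem_nth// -has_find | apply: (nth_find [::] hb)].
have blkE b j : b \in bs -> j \in b -> blk j = b.
  by move=> bbs jb; have [bj jbj] := blkP j; apply: (uniq_flatten_inj ubs _ _ jbj).
have ub b : b \in bs -> uniq b.
  move=> /rot_to[k bs' bsE].
  have : uniq (flatten (rot k bs)).
    rewrite (perm_uniq (_ : perm_eq _ (flatten bs)))//.
    by apply: perm_flatten; rewrite perm_rot.
  by rewrite bsE /= cat_uniq => /and3P[].
pose f j := next (blk j) j.
have f_inj : injective f.
  move=> j j' fjj'; have [bj jb] := blkP j; have [bj' jb'] := blkP j'.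
  have bb : blk j = blk j'.
    apply: (uniq_flatten_inj ubs bj bj' (j := f j)); first by rewrite mem_next.
    by rewrite fjj' mem_next.
  rewrite -(prev_next (ub _ bj) j) -(prev_next (ub _ bj') j').
  by rewrite -/(f j) fjj' bb.
exists (perm f_inj); apply/allP => b bbs.
rewrite -(@eq_in_cycle _ [in b] (frel (next b))); first exact: cycle_next (ub b bbs).
  by move=> j j' jb _ /=; rewrite permE /f (blkE b).
exact/allP.
Qed.

Definition nontrivial_min s : pred 'I_n :=
  fun i => orbit_min s i && (s i != i).

(** A cycle of length at least 2 is counted through its least element. *)
Definition nt_cycles s : nat := #|nontrivial_min s|.

Lemma size_orbit_gt1 s i : (1 < size (orbit s i))%N = (s i != i).
Proof.
have [sii|sii] := eqVneq (s i) i.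
  have c : fcycle s [:: i] by rewrite /= sii eqxx.
  by rewrite (orbitE c _ (mem_head _ _)) //= eqxx.
have : (size [:: i; s i] <= size (orbit s i))%N.
  apply: uniq_leq_size => [|j]; first by rewrite /= inE eq_sym sii.
  rewrite in_cons mem_seq1 => /orP[] /eqP ->; first exact: in_orbit.
  by apply: mem_orbit; apply: in_orbit.
by [].
Qed.

Variables (K : fieldType).

Definition cycle_prod (A : poissonAlgType K) (x : 'I_n -> A) s : A :=
  \prod_(i | orbit_min s i) lnorm x (orbit s i).

Definition min_head (b : seq 'I_n) : bool :=
  if b is i :: c then all (fun j : 'I_n => i <= j)%N c else false.

(** Up to order the blocks are the cycles: each one is the orbit of its head,
    and being least the head is the chosen starting point. *)
Lemma cycle_prod_blocks (A : poissonAlgType K) (x : 'I_n -> A) s bs :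
    perm_eq (flatten bs) (enum 'I_n) -> all (fcycle s) bs -> all min_head bs ->
  cycle_prod x s = \prod_(b <- bs) lnorm x b.
Proof.
move=> bsn cbs mbs.
have ubs : uniq (flatten bs) by rewrite (perm_uniq bsn) enum_uniq.
have [is_ bsE mis] : exists2 is_, bs = [seq orbit s i | i <- is_] &
    all (orbit_min s) is_.
  elim: bs cbs mbs ubs {bsn} => [|b bs IHbs] /=; first by exists [::].
  move=> /andP[cb cbs] /andP[mb mbs]; rewrite cat_uniq => /and3P[ub _ ubs].
  have [is_ -> mis] := IHbs cbs mbs ubs.
  case: b cb mb ub => // i c cb mb ub.
  have bE : i :: c = orbit s i.
    by rewrite (orbitE cb ub (mem_head _ _)) /= eqxx rot0.
  exists (i :: is_); first by rewrite bE.
  rewrite /= mis andbT; apply/orbit_minP => j.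
  by rewrite -bE inE => /predU1P[->//|jc]; apply: (allP mb).
subst bs; rewrite big_map /cycle_prod -big_enum /=.
apply: perm_big; apply: uniq_perm; rewrite ?enum_uniq//.
  apply: uniq_flatten_map ubs => i /(congr1 (fun b => i \in b)).
  by rewrite in_orbit.
move=> i; rewrite mem_enum; apply/idP/idP => [mi|]; last exact: (allP mis).
have : i \in flatten [seq orbit s i | i <- is_].
  by rewrite (perm_mem bsn) mem_enum.
move=> /flatten_mapP[i' i'is ii'].
by rewrite (orbit_min_inj mi (allP mis _ i'is) (in_orbit _ _) ii').
Qed.

Lemma cycle_prod_morph (A B : poissonAlgType K) (h : A -> B) (x : 'I_n -> A) s :
  poisson_morphism h -> h (cycle_prod x s) = cycle_prod (h \o x) s.
Proof.
move=> [_ [h1 hM] hL].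
rewrite /cycle_prod (big_morph h hM h1); apply: eq_bigr => i _.
rewrite lnorm_morph// => /(congr1 (fun b => i \in b)).
by rewrite in_orbit.
Qed.

(** The monomials use the variables from 1 to n, whereas ordinals start at 0. *)
Definition Xvar j : freePoisson K := pvar K j.+1.

Let lab : seq 'I_n -> seq nat := map (fun j => j.+1).

Let map_enum_succ : lab (enum 'I_n) = iota 1 n.
Proof.
rewrite /lab (map_comp S val) val_enum_ord.
by rewrite -[1%N]addn0 iotaDl.
Qed.

Let ex_labels (b : seq nat) : {subset b <= iota 1 n} -> exists c, b = lab c.
Proof.
elim: b => [|k b IHb] kb; first by exists [::].
have [c ->] : exists c, b = lab c.
  by apply: IHb => j jb; apply: kb; rewrite inE jb orbT.
have : k \in lab (enum 'I_n) by rewrite map_enum_succ kb ?mem_head.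
by move=> /mapP[i _ ->]; exists (i :: c).
Qed.

(** Every product of commutators expands into products of left-normed ones with
    the least variable first, and a family of such words covering all the
    variables once is the cycle decomposition of a permutation. *)
Lemma P_span_cycle_prod f : @P_ K n f ->
  lin_span (range (@cycle_prod (freePoisson K) Xvar)) f.
Proof.
apply: (@lin_span_image _ _ _ id) => // _ [ts [tsn ->]].
apply: (@lin_span_image _ _ _ id) (prod_comm_val_span K ts) => //.
move=> _ [bs [bsts mbs ->]].
have bsn := perm_trans bsts tsn.
have [cs bsE] : exists cs, bs = map lab cs.
  have : {subset flatten bs <= iota 1 n} by move=> i; rewrite (perm_mem bsn).
  elim: bs {bsts mbs bsn} => [|b bs IHbs] sub; first by exists [::].
  have [cs ->] : exists cs, bs = map lab cs.
    by apply: IHbs => i ib; apply: sub; rewrite mem_cat ib orbT.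
  have [c ->] : exists c, b = lab c.
    by apply: ex_labels => i ib; apply: sub; rewrite mem_cat ib.
  by exists (c :: cs).
subst bs; have csn : perm_eq (flatten cs) (enum 'I_n).
  apply: (@perm_map_inj _ _ (fun j : 'I_n => j.+1)); first by move=> i j [] /val_inj.
  by rewrite -/(lab _) -/(lab _) map_enum_succ /lab map_flatten.
have [s cs_s] := ex_perm_fcycle csn.
apply: lin_span_mem; exists s => //.
rewrite (cycle_prod_blocks _ csn cs_s).
  by rewrite big_map; apply: eq_bigr => c _; rewrite lnorm_map.
move: mbs; rewrite all_map; apply: sub_all => -[|i c] //=.
by rewrite all_map; apply: sub_all.
Qed.

Let comm_of (b : seq nat) : lie_comm :=
  if b is i :: c then foldl (fun t (k : nat) => Comm2 t (Comm1 k)) (Comm1 i) c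
  else Comm1 0.

Let comm_of_vars b : b <> [::] -> comm_vars (comm_of b) = b.
Proof.
case: b => // i c _ /=; elim/last_ind: c => //= c j IHc.
by rewrite foldl_rcons /= IHc cats1.
Qed.

Let comm_of_val b : b <> [::] -> comm_val K (comm_of b) = lnorm (pvar K) b.
Proof.
case: b => // i c _ /=; elim/last_ind: c => //= c j IHc.
by rewrite !foldl_rcons /= IHc.
Qed.

Lemma cycle_prod_multilinear s :
  @multilinear_monomial K n (cycle_prod Xvar s).
Proof.
have orbit0 i : lab (orbit s i) <> [::].
  have : i \in orbit s i by apply: in_orbit.
  by case: (orbit s i).
exists [seq comm_of (lab (orbit s i)) | i <- enum (orbit_min s)]; split.
  rewrite -map_comp (eq_map (_ : _ =1 lab \o orbit s)); last first.
    by move=> i /=; rewrite comm_of_vars.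
  rewrite map_comp -map_flatten -map_enum_succ.
  exact/perm_map/orbits_partition.
rewrite big_map big_enum /=; apply: eq_bigr => i _.
by rewrite comm_of_val// lnorm_map.
Qed.

End CycleProduct.

(** * Quotients of Poisson algebras *)

(** Ideals are proper, since the quotient must again satisfy 1 != 0. *)
Record poisson_ideal (K : fieldType) (A : poissonAlgType K) := PoissonIdeal {
  pideal_mem : {pred A};
  pideal_closed : idealr_closed pideal_mem;
  pideal_lie : forall f g, f \in pideal_mem -> lie f g \in pideal_mem
}.

HB.instance Definition _ K A (J : @poisson_ideal K A) :=
  isIdealr.Build A (pideal_mem J) (pideal_closed J).

Section PoissonQuotient.
Local Open Scope quotient_scope.
Variables (K : fieldType) (A : poissonAlgType K) (J : poisson_ideal A).
Local Notation I := (pideal_mem J).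
Implicit Types (f g : A) (a : K).

Definition pquot := {ideal_quot (pideal_mem J)}.

HB.instance Definition _ := GRing.ComNzRing.on pquot.

Definition pquot_pi f : pquot := \pi_{ideal_quot I} f.

Let pquot_repr (u : pquot) : A := repr (u : {ideal_quot I}).

Lemma pquot_eqP f g : reflect (pquot_pi f = pquot_pi g) (f - g \in I).
Proof. by rewrite Quotient.idealrBE; apply: eqP. Qed.

Let reprP f : pquot_repr (pquot_pi f) - f \in I.
Proof. by apply/pquot_eqP; apply: (reprK (qT := {ideal_quot I})). Qed.

Lemma pquotW (P : pquot -> Prop) : (forall f, P (pquot_pi f)) -> forall u, P u.
Proof. by move=> Pf u; rewrite -[u](reprK (qT := {ideal_quot I})); apply: Pf. Qed.

Lemma pquot_piD : {morph pquot_pi : f g / f + g}.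
Proof. by move=> f g; rewrite /pquot_pi Quotient.pi_add. Qed.

Lemma pquot_piM : {morph pquot_pi : f g / f * g}.
Proof. by move=> f g; rewrite /pquot_pi Quotient.pi_mul. Qed.

Lemma pquot_pi1 : pquot_pi 1 = 1.
Proof. by rewrite /pquot_pi [RHS]piE. Qed.

Definition pquot_scale a (u : pquot) : pquot := pquot_pi (a *: pquot_repr u).
Definition pquot_lie (u v : pquot) : pquot :=
  pquot_pi (lie (pquot_repr u) (pquot_repr v)).

Lemma pquot_scaleE a f : pquot_scale a (pquot_pi f) = pquot_pi (a *: f).
Proof.
by apply/pquot_eqP; rewrite -scalerBr -mulr_algl; apply/idealMr/reprP.
Qed.

Lemma pquot_lieE f g : pquot_lie (pquot_pi f) (pquot_pi g) = pquot_pi (lie f g).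
Proof.
apply/pquot_eqP; set f' := pquot_repr _; set g' := pquot_repr _.
have -> : lie f' g' - lie f g = lie (f' - f) g' - lie (g' - g) f.
  rewrite (linB (linear_liel g')) (linB (linear_liel f)).
  by rewrite /= (lie_antisym g' f) (lie_antisym g f); ring.
by apply: rpredB; apply/pideal_lie/reprP.
Qed.

Let E := (pquot_scaleE, pquot_lieE).

Let scaleA a b u : pquot_scale a (pquot_scale b u) = pquot_scale (a * b) u.
Proof. by elim/pquotW: u => f; rewrite !E scalerA. Qed.
Let scale1 : left_id 1 pquot_scale.
Proof. by elim/pquotW=> f; rewrite !E scale1r. Qed.
Let scaleDr : right_distributive pquot_scale +%R.
Proof.
move=> a; do 2![elim/pquotW=> ?].
by rewrite -pquot_piD !E scalerDr pquot_piD.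
Qed.
Let scaleDl u : {morph pquot_scale^~ u : a b / a + b}.
Proof. by move=> a b; elim/pquotW: u => f; rewrite !E scalerDl pquot_piD. Qed.

HB.instance Definition _ := GRing.Zmodule_isLmodule.Build K pquot
  scaleA scale1 scaleDr scaleDl.

Lemma pquot_piZ a f : pquot_pi (a *: f) = a *: pquot_pi f.
Proof. by rewrite [RHS]E. Qed.

Lemma pquot_pi_linear : linear pquot_pi.
Proof. by move=> a f g; rewrite pquot_piD pquot_piZ. Qed.

Let linl v : linear (pquot_lie^~ v).
Proof.
move=> a; elim/pquotW=> f; elim/pquotW=> g; elim/pquotW: v => h.
by rewrite -pquot_pi_linear !E linear_liel pquot_pi_linear.
Qed.
Let linr u : linear (pquot_lie u).
Proof.
move=> a; elim/pquotW=> f; elim/pquotW=> g; elim/pquotW: u => h.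
by rewrite -pquot_pi_linear !E linear_lier pquot_pi_linear.
Qed.
Let lxx u : pquot_lie u u = 0.
Proof. by elim/pquotW: u => f; rewrite E liexx (lin0 pquot_pi_linear). Qed.
Let ljacobi u v w :
  pquot_lie u (pquot_lie v w) + pquot_lie v (pquot_lie w u)
    + pquot_lie w (pquot_lie u v) = 0.
Proof.
elim/pquotW: u => f; elim/pquotW: v => g; elim/pquotW: w => h.
by rewrite !E -!pquot_piD jacobi (lin0 pquot_pi_linear).
Qed.

HB.instance Definition _ := Lmodule_isLie.Build K pquot linl linr lxx ljacobi.

Let scaleAl a (u v : pquot) : a *: (u * v) = (a *: u) * v.
Proof.
elim/pquotW: u => f; elim/pquotW: v => g.
by rewrite -pquot_piM -!pquot_piZ -pquot_piM scalerAl.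
Qed.

HB.instance Definition _ := GRing.Lmodule_isLalgebra.Build K pquot scaleAl.
HB.instance Definition _ := GRing.Lalgebra_isComAlgebra.Build K pquot.

Lemma pquot_piL : {morph pquot_pi : f g / lie f g}.
Proof. by move=> f g; rewrite [RHS]E. Qed.

Let qleibniz (u v w : pquot) : lie (u * v) w = u * lie v w + v * lie u w.
Proof.
elim/pquotW: u => f; elim/pquotW: v => g; elim/pquotW: w => h.
by rewrite -pquot_piM -!pquot_piL -!pquot_piM -pquot_piD leibniz.
Qed.

HB.instance Definition _ := Lie_isPoisson.Build K pquot qleibniz.

Lemma pquot_pi_morphism : poisson_morphism pquot_pi.
Proof.
split; first exact: pquot_pi_linear.
  by split=> [|f g]; [apply: pquot_pi1 | apply: pquot_piM].
exact: pquot_piL.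
Qed.

End PoissonQuotient.

(** * The ideal generated by the products of s brackets *)

Section BracketIdeal.
Variables (K : fieldType) (A : poissonAlgType K).
Implicit Types (f g : A) (s : nat) (ps : seq (A * A)).

Definition bracket_ideal s : set A :=
  lin_span [set f | exists g ps, size ps = s /\
                      f = g * \prod_(p <- ps) lie p.1 p.2]%classic.

Lemma bracket_idealM s f g : bracket_ideal s g -> bracket_ideal s (f * g).
Proof.
apply: (@lin_span_image _ _ _ ( *%R f)) => [a u v|_ [h [ps [ps_s ->]]]].
  by rewrite mulrDr scalerAr.
by apply: lin_span_mem; exists (f * h), ps; rewrite mulrA.
Qed.

(** By the Leibniz rule, a bracket with g either falls on the coefficient, and s
    brackets remain, or it replaces one bracket {p, q} by {{p, q}, g}, which is
    a bracket again. *)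
Lemma bracket_ideal_lie s f g : bracket_ideal s f -> bracket_ideal s (lie f g).
Proof.
apply: (@lin_span_image _ _ _ (lie^~ g) _ _ (linear_liel g)).
move=> _ [h [ps [<- ->]]] {s}; elim: ps h => [|[p q] ps IHps] h.
  apply: lin_span_mem; rewrite big_nil mulr1.
  by exists (lie h g), [::]; rewrite big_nil mulr1.
rewrite big_cons mulrCA leibniz /=; apply: lin_spanD; last first.
  apply: lin_span_mem; exists h, ((lie p q, g) :: ps); split=> //.
  by rewrite big_cons /= mulrAC mulrA.
apply: (@lin_span_image _ _ _ ( *%R (lie p q))) (IHps h).
  by move=> a u v; rewrite mulrDr scalerAr.
move=> _ [h' [ps' [ps'_s ->]]]; apply: lin_span_mem.
exists h', ((p, q) :: ps'); split; first by rewrite /= ps'_s.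
by rewrite big_cons /= mulrCA.
Qed.

Definition bracket_pideal s (nt : ~ bracket_ideal s 1) : poisson_ideal A.
Proof.
exists (fun f => `[< bracket_ideal s f >]).
- split=> [||a u v /asboolP Iu /asboolP Iv].
  + exact/asboolP/lin_span0.
  + exact/asboolP.
  + by apply/asboolP/lin_spanD => //; apply: bracket_idealM.
- by move=> f g /asboolP If; apply/asboolP/bracket_ideal_lie.
Defined.

(** The values of the variables lift to A, where the identity evaluates to a
    product of s brackets. *)
Lemma pquot_brackets_vanish s (nt : ~ bracket_ideal s 1) :
  @W_ K s (pquot (bracket_pideal nt)).
Proof.
set Q := pquot _ => _ -> h [hl [h1 hM] hL].
rewrite (big_morph h hM h1).
under eq_bigr do rewrite hL.
pose y i := repr (h (pvar K i) : {ideal_quot (pideal_mem (bracket_pideal nt))})%qT.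
have [_ [p1 pM] pL] := pquot_pi_morphism (bracket_pideal nt).
have yE i : h (pvar K i) = pquot_pi (bracket_pideal nt) (y i).
  by apply/esym; apply: reprK.
under eq_bigr do rewrite !yE -pL.
rewrite -(big_morph (pquot_pi _) pM p1) -(lin0 (pquot_pi_linear (bracket_pideal nt))).
apply/pquot_eqP; rewrite subr0; apply/asboolP/lin_span_mem.
exists 1, [seq (y (2 * i - 1)%N, y (2 * i)%N) | i <- index_iota 1 s.+1].
by rewrite size_map size_iota subn1 mul1r big_map.
Qed.

End BracketIdeal.

(** * Separating permutations in the symmetric algebra of gl_n *)

Section GeneralLinear.
Variables (K : fieldType) (n : nat).

Definition gl := 'M[K]_n.

HB.instance Definition _ := GRing.Lmodule.on gl.

Definition mxlie (M N : gl) : gl := M *m N - N *m M.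

Let mxlie_linl N : linear (mxlie^~ N).
Proof.
move=> a M M'; rewrite /mxlie mulmxDl mulmxDr -scalemxAl -scalemxAr scalerBr.
by rewrite opprD addrACA.
Qed.
Let mxlie_linr M : linear (mxlie M).
Proof.
move=> a N N'; rewrite /mxlie mulmxDl mulmxDr -scalemxAl -scalemxAr scalerBr.
by rewrite opprD addrACA.
Qed.
Let mxliexx M : mxlie M M = 0. Proof. exact: subrr. Qed.
Let mxlie_jacobi M N P :
  mxlie M (mxlie N P) + mxlie N (mxlie P M) + mxlie P (mxlie M N) = 0.
Proof.
rewrite /mxlie !(mulmxBl, mulmxBr) !mulmxA.
move: (M *m N *m P) (M *m P *m N) (N *m M *m P) (N *m P *m M) (P *m M *m N)
  (P *m N *m M) => a b c d e f.
by apply/matrixP => i j; rewrite !mxE; ring.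
Qed.

HB.instance Definition _ := Lmodule_isLie.Build K gl
  mxlie_linl mxlie_linr mxliexx mxlie_jacobi.

End GeneralLinear.

(** Constants have zero bracket, so shifting the arguments by scalars is only
    visible in commutators of length 1. *)
Lemma lnorm_sym_in (K : fieldType) (L : lieAlgType K) (T : Type) (c : T -> K)
    (M : T -> L) i s :
  lnorm (fun j => (c j)%:A + sym_in (M j)) (i :: s) =
    (if s is [::] then c i else 0)%:A + sym_in (lnorm M (i :: s)).
Proof.
elim/last_ind: s => [//|s j IHs].
rewrite -rcons_cons !lnorm_rcons// IHs.
have -> : (if rcons s j is [::] then c i else 0) = 0 by case: (s).
rewrite scale0r add0r lieDl lie_algl add0r lieDr lie_sym_in.
by rewrite lie_antisym lie_algl oppr0 add0r.
Qed.

Section CycleDetector.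
Variables (K : fieldType) (n : nat) (t : 'S_n).
Implicit Types (i j m : 'I_n) (b : seq 'I_n) (M : gl K n).

(** A product of these matrix units along a word is nonzero only if the word
    follows the arrows j -> t j. *)
Definition edge_mx j : gl K n := delta_mx j (t j).

(** The full trace vanishes on commutators; restricting it to one diagonal entry
    for each nontrivial cycle of t makes it see exactly these cycles. *)
Definition cycle_trace M : K := \sum_(m | nontrivial_min t m) M m m.

Lemma row_edge_mx m j : m != j -> row m (edge_mx j) = 0.
Proof. by move=> mj; apply/rowP => k; rewrite !mxE (negPf mj). Qed.

(** Only row j of the matrix of j is nonzero, so left multiplication by it does
    not contribute to row m unless j = m. Hence among the words in the expansion
    of the commutator, row m only sees the one that keeps the order of the
    letters. *)
Lemma row_lnorm_edge m i b : m \notin b ->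
  row m (lnorm edge_mx (i :: b)) =
  if fpath t i b then row m (delta_mx i (t (last i b))) else 0.
Proof.
elim/last_ind: b => [//|b j IHb]; rewrite mem_rcons inE negb_or => /andP[mj mb].
rewrite -rcons_cons lnorm_rcons// [lie _ _]/(_ - _) linearB /= !row_mul.
rewrite (row_edge_mx mj) mul0mx subr0 IHb// rcons_path last_rcons.
case: ifP => _ /=; last by rewrite mul0mx.
rewrite -row_mul mul_delta_mx_cond eq_sym.
by case: eqP => _; rewrite ?mulr1n// mulr0n linear0.
Qed.

(** A row in D only sees words beginning in D; a word that follows the arrows of
    t from there never meets the letter i. *)
Lemma row_lnorm_invariant (D : {pred 'I_n}) m i b :
    {homo t : j / j \in D} -> m \in D -> i \notin D ->
  row m (lnorm edge_mx (i :: b)) = 0.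
Proof.
move=> tD + iD; elim/last_ind: b m => [|b j IHb] m mD.
  by rewrite row_edge_mx//; apply: contraNneq iD => <-.
rewrite -rcons_cons lnorm_rcons// [lie _ _]/(_ - _) linearB /= !row_mul IHb//.
rewrite mul0mx sub0r; have [<-|mj] := eqVneq m j; last first.
  by rewrite row_edge_mx// mul0mx oppr0.
suff -> : row m (edge_mx m) = delta_mx 0 (t m) by rewrite -rowE IHb ?oppr0 ?tD.
by apply/rowP => k; rewrite !mxE !eqxx.
Qed.

(** At the least element m of a cycle of t, with m different from i, the entry
    vanishes: if i lies on the cycle of m then m < i, so m is not a letter of
    the commutator; if it does not, the orbit of m is an invariant set without i.
    At i itself the entry is that of the product along the word i :: b. *)
Lemma cycle_trace_lnorm i b : uniq (i :: b) -> b <> [::] ->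
    (forall j, j \in b -> (i <= j)%N) ->
  cycle_trace (lnorm edge_mx (i :: b)) = (fcycle t (i :: b))%:R.
Proof.
move=> ub b0 ib; have /andP[i_b _] := ub.
have off m : nontrivial_min t m -> m != i -> lnorm edge_mx (i :: b) m m = 0.
  move=> /andP[/orbit_minP mt _] mi.
  suff /rowP/(_ m) : row m (lnorm edge_mx (i :: b)) = 0 by rewrite !mxE.
  have [im|im] := boolP (i \in orbit t m); last first.
    apply: row_lnorm_invariant im; last exact: in_orbit.
    by move=> j; apply: mem_orbit.
  rewrite row_lnorm_edge.
    case: ifP => // _; apply/rowP => k; rewrite !mxE (negPf mi) //.
  apply: contra mi => /ib im'.
  by rewrite -val_eqE eqn_leq im' mt.
have diag : lnorm edge_mx (i :: b) i i = (fcycle t (i :: b))%:R.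
  have /rowP/(_ i) := row_lnorm_edge i i_b; rewrite !mxE /= rcons_path => ->.
  by case: (path _ _ _); rewrite !mxE ?eqxx// eq_sym.
have [nti|nti] := boolP (nontrivial_min t i).
  rewrite /cycle_trace (bigD1 i)//= -/(lnorm _ _) diag big1 ?addr0// => m.
  by move=> /andP[]; apply: off.
rewrite [cycle_trace _]big1 => [|m mt]; last first.
  by apply: off => //; apply: contraNneq nti => <-.
have [c|//] := boolP (fcycle t (i :: b)); case/negP: nti; apply/andP; split.
  apply/orbit_minP => j; rewrite (orbitE c ub (mem_head _ _)) /= eqxx rot0.
  by rewrite inE => /predU1P[->|/ib].
case: b b0 c i_b {ub ib off diag} => // j b _ /= /andP[/eqP -> _].
by rewrite inE negb_or eq_sym => /andP[].
Qed.

(** Matrices get degree 1, so that products of s brackets are sent to multiples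
    of 'X^s, while a permutation with fewer nontrivial cycles stays visible in
    lower degree. *)
Definition gauge : symalg (gl K n) -> {poly K} :=
  sym_lift (fun M => cycle_trace M *: 'X).

Lemma cycle_trace_linear : linear (fun M => cycle_trace M *: 'X : {poly K}).
Proof.
move=> a M N; rewrite /cycle_trace scalerA -scalerDl mulr_sumr -big_split /=.
by congr (_ *: _); apply: eq_bigr => m _; rewrite !mxE.
Qed.

Lemma gauge_linear : linear gauge.
Proof. exact: sym_lift_linear cycle_trace_linear. Qed.

Lemma gauge_monoid_morphism : monoid_morphism gauge.
Proof. exact: sym_lift_monoid_morphism cycle_trace_linear. Qed.

Lemma gauge_in M : gauge (sym_in M) = cycle_trace M *: 'X.
Proof. exact: sym_lift_in cycle_trace_linear M. Qed.

(** Every bracket in the symmetric algebra lies in the ideal generated by the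
    matrices. *)
Lemma gauge_lie f g : exists q, gauge (lie f g) = q * 'X.
Proof.
have gD := linD gauge_linear; have [_ gM] := gauge_monoid_morphism.
have gA u v w z : (exists q, gauge w = q * 'X) -> (exists q, gauge z = q * 'X) ->
    exists q, gauge (u * w + v * z) = q * 'X.
  move=> [q wE] [q' zE]; exists (gauge u * q + gauge v * q').
  by rewrite gD !gM wE zE mulrDl !mulrA.
have gA1 w z : (exists q, gauge w = q * 'X) -> (exists q, gauge z = q * 'X) ->
    exists q, gauge (w + z) = q * 'X.
  by rewrite -{2}[w]mul1r -{2}[z]mul1r; apply: gA.
have g0 : exists q, gauge 0 = q * 'X.
  by exists 0; rewrite (lin0 gauge_linear) mul0r.
elim/sym_ind: g => [N|c|g g' IHg IHg'|g g' IHg IHg'].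
- elim/sym_ind: f => [M|c|f f' IHf IHf'|f f' IHf IHf'].
  + by rewrite lie_sym_in gauge_in -mul_polyC; eexists.
  + by rewrite lie_algl.
  + by rewrite lieDl; apply: gA1.
  + by rewrite leibniz; apply: gA.
- by rewrite lie_antisym lie_algl oppr0.
- by rewrite lieDr; apply: gA1.
- by rewrite leibnizr; apply: gA.
Qed.

Lemma coef_gauge_bracket_ideal s f k :
  bracket_ideal s f -> (k < s)%N -> (gauge f)`_k = 0.
Proof.
move=> If ks; move: f If.
apply: (@lin_span_ker _ _ K^o (fun f => (gauge f)`_k)) => [a u v|].
  by rewrite (linD gauge_linear) (linZ gauge_linear) coefD coefZ.
move=> _ [g [ps [pss ->]]].
have [_ gM] := gauge_monoid_morphism.
suff [q ->] : exists q, gauge (g * \prod_(p <- ps) lie p.1 p.2) = q * 'X^s.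
  by rewrite coefMXn ks.
elim: ps s pss {ks k} => [s <-|p ps IHps _ <-] /=.
  by exists (gauge (g * \prod_(p <- [::]) lie p.1 p.2)); rewrite expr0 mulr1.
have [q qE] := IHps _ erefl; have [q' q'E] := gauge_lie p.1 p.2.
by exists (q' * q); rewrite big_cons mulrCA gM qE q'E exprS mulrACA.
Qed.

Lemma bracket_ideal_proper s : (0 < s)%N ->
  ~ bracket_ideal (A := symalg (gl K n)) s 1.
Proof.
move=> s0 /coef_gauge_bracket_ideal/(_ s0)/eqP.
by case: gauge_monoid_morphism => -> _; rewrite coef1 oner_eq0.
Qed.

(** The scalar 1 detects the fixed points of t in degree 0. *)
Definition detector j : symalg (gl K n) :=
  ((t j == j)%:R : K)%:A + sym_in (edge_mx j).

Lemma gauge_lnorm i b : uniq (i :: b) -> (forall j, j \in b -> (i <= j)%N) ->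
  gauge (lnorm detector (i :: b)) =
    (fcycle t (i :: b))%:R *: 'X^(1 < size (i :: b))%N.
Proof.
move=> ub ib; rewrite /detector lnorm_sym_in (linD gauge_linear) gauge_in.
have [g1 _] := gauge_monoid_morphism; rewrite (linZ gauge_linear) g1.
case: b ub ib => [|j b] ub ib; last first.
  by rewrite scale0r add0r cycle_trace_lnorm.
rewrite /= andbT [cycle_trace _]big1 ?scale0r ?addr0 ?expr0// => m /andP[_ tm].
rewrite mxE; case: eqP => // <-; by rewrite eq_sym (negPf tm).
Qed.

(** If all cycles of s follow the arrows of t, then s and t agree everywhere. *)
Lemma gauge_cycle_prod s :
  gauge (cycle_prod detector s) = (s == t)%:R *: 'X^(nt_cycles s).
Proof.
have [g1 gM] := gauge_monoid_morphism.
rewrite /cycle_prod (big_morph gauge gM g1).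
have E i : orbit_min s i -> gauge (lnorm detector (orbit s i)) =
    (fcycle t (orbit s i))%:R *: 'X^(s i != i).
  rewrite -size_orbit_gt1 => /orbit_minP.
  have := orbit_uniq s i; rewrite /orbit -orderSpred trajectS.
  set b := traject _ _ _ => ub im; rewrite gauge_lnorm// => j jb.
  by apply: im; rewrite inE jb orbT.
rewrite (eq_bigr _ E) scaler_prod -expr_sum; congr (_ *: 'X^_); last first.
  rewrite /nt_cycles -sum1_card [RHS](eq_bigl (nontrivial_min s))//.
  rewrite [RHS]big_mkcondr /=; apply: eq_bigr => i _.
  by case: ifP.
have [<-|st] := eqVneq s t.
  by rewrite big1// => i _; rewrite cycle_orbit//; apply: perm_inj.
have /existsP[j stj] : [exists j, s j != t j].
  by apply: contraNT st; rewrite negb_exists => /forallP H; apply/eqP/permP => j;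
    have /negPn/eqP := H j.
have [i mi ji] := orbit_min_ex s j.
apply/eqP; rewrite prodf_seq_eq0; apply/hasP; exists i.
  by rewrite mem_index_enum.
rewrite mi /=; case: (boolP (fcycle t _)) => // c; case/negP: stj.
have /eqP/= -> := next_cycle c ji.
have cs : fcycle s (orbit s i) by apply: cycle_orbit; apply: perm_inj.
by have /eqP/= -> := next_cycle cs ji.
Qed.

(** Evaluate at the detectors of t modulo products of s brackets, and read off
    the coefficient of 'X^(nt_cycles t). *)
Lemma identities_W_coef s (c : 'S_n -> K) : (0 < s)%N -> (nt_cycles t < s)%N ->
    identities (@W_ K s) (\sum_r c r *: cycle_prod (@Xvar n K) r) ->
  c t = 0.
Proof.
move=> s0 ts Wf; have nt := @bracket_ideal_proper s s0.
have {Wf} Id := Wf _ (@pquot_brackets_vanish _ _ s nt).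
(* The variable X_(j+1) stands for the letter j. *)
pose y k := if insub k.-1 is Some j then detector j else 0.
have gP := freePoisson_lift_morphism y; set g := freePoisson_lift y in gP.
have qP := pquot_pi_morphism (bracket_pideal nt).
have := Id _ (poisson_morphism_comp qP gP).
rewrite /= -[RHS](lin0 (pquot_pi_linear _)) => /pquot_eqP.
rewrite subr0 => /asboolP/coef_gauge_bracket_ideal/(_ ts).
have lin_sum (f : freePoisson K -> {poly K}) : linear f ->
    f (\sum_r c r *: cycle_prod (@Xvar n K) r) =
    \sum_r c r *: f (cycle_prod (@Xvar n K) r).
  move=> fl; rewrite (big_morph f (linD fl) (lin0 fl)).
  by apply: eq_bigr => r _; rewrite (linZ fl).
have [gl_ _ _] := gP.
rewrite [gauge _](lin_sum (gauge \o g)); last first.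
  by move=> a u v /=; rewrite gl_ gauge_linear.
rewrite (bigD1 t)//= big1 ?addr0 => [|r rt].
  rewrite cycle_prod_morph// [cycle_prod _ _](_ : _ = cycle_prod detector t).
    by rewrite gauge_cycle_prod eqxx scale1r coefZ coefXn eqxx mulr1.
  apply: eq_bigr => i _; congr lnorm; apply/funext => j /=.
  by rewrite /g freePoisson_lift_var /y /= valK.
rewrite cycle_prod_morph// [cycle_prod _ _](_ : _ = cycle_prod detector r).
  by rewrite gauge_cycle_prod (negPf rt) scale0r scaler0.
apply: eq_bigr => i _; congr lnorm; apply/funext => j /=.
by rewrite /g freePoisson_lift_var /y /= valK.
Qed.

End CycleDetector.

(** * The codimensions of W_s *)

(** The defining identity is evaluated by sending X_(2i-1) and X_(2i) to the
    entries of the i-th pair. *)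
Lemma prod_brackets_eq0 (K : fieldType) (A : poissonAlgType K) s ps :
  @W_ K s A -> size ps = s -> \prod_(p <- ps) lie p.1 p.2 = 0 :> A.
Proof.
move=> WA pss; pose p i := nth (0, 0) ps i.
pose y k := if odd k then (p k.-1./2).1 else (p k.-1./2).2.
have hP := freePoisson_lift_morphism y; have [_ [h1 hM] hL] := hP.
have := WA _ erefl _ hP; rewrite (big_morph _ hM h1) => <-.
rewrite (big_nth (0, 0)) pss big_add1 /=; apply: eq_bigr => i _.
rewrite hL !freePoisson_lift_var /y mulnS add2n subn1 /= mul2n odd_double /=.
by rewrite doubleK uphalf_double.
Qed.

(** A left-normed commutator of length at least 2 is a bracket, so every
    nontrivial cycle contributes one. *)
Lemma cycle_prod_eq0 (K : fieldType) (A : poissonAlgType K) n s (x : 'I_n -> A)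
    (r : 'S_n) : @W_ K s A -> (s <= nt_cycles r)%N ->
  cycle_prod x r = 0.
Proof.
move=> WA sr; rewrite /cycle_prod (bigID (fun i => r i != i)) /=.
have -> : \prod_(i | orbit_min r i && (r i != i)) lnorm x (orbit r i) =
    \prod_(i <- enum (nontrivial_min r)) lnorm x (orbit r i) by rewrite big_enum.
suff -> : \prod_(i <- enum (nontrivial_min r)) lnorm x (orbit r i) = 0.
  by rewrite mul0r.
have [ps [ps_s ->]] : exists ps : seq (A * A), (s <= size ps)%N /\
    \prod_(i <- enum (nontrivial_min r)) lnorm x (orbit r i) =
    \prod_(p <- ps) lie p.1 p.2.
  move: sr; rewrite /nt_cycles cardE.
  have : all (fun i => r i != i) (enum (nontrivial_min r)).
    by apply/allP => i; rewrite mem_enum => /andP[].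
  elim: (enum _) s {WA} => [|i l IHl] s.
    by move=> _ s0; exists [::]; rewrite !big_nil.
  move=> /= /andP[ri /IHl{}IHl] sl.
  have [ps [ps_s E]] : exists ps : seq (A * A), (s.-1 <= size ps)%N /\
      \prod_(i <- l) lnorm x (orbit r i) = \prod_(p <- ps) lie p.1 p.2.
    by apply: IHl; case: (s) sl.
  have [p pE] : exists p : A * A, lnorm x (orbit r i) = lie p.1 p.2.
    move: ri; rewrite -size_orbit_gt1; case/lastP: (orbit r i) => //= b j.
    rewrite size_rcons ltnS => b0.
    by exists (lnorm x b, x j); rewrite lnorm_rcons//; case: (b) b0.
  exists (p :: ps); rewrite !big_cons pE E; split=> //=.
  by move: ps_s; case: (s).
rewrite -(cat_take_drop s ps) big_cat /= (prod_brackets_eq0 WA) ?mul0r//.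
by rewrite size_take_min; apply/minn_idPl.
Qed.

(** The products attached to these permutations span by [cycle_prod_eq0] and are
    independent by [identities_W_coef]. *)
Lemma codimE (K : fieldType) (s n : nat) : (0 < s)%N ->
  codim (@W_ K s) n = #|[pred r : 'S_n | (nt_cycles r < s)%N]|.
Proof.
move=> s0; set W := @W_ K s; set Q := [pred r | _].
pose m r := relfree_pi W (cycle_prod (@Xvar n K) r).
pose b (k : 'I_#|Q|) := m (enum_val k).
have pl := @relfree_pi_linear _ W.
suff D : is_dim (relfree_pi W @` @P_ K n)%classic #|Q|.
  apply: (is_dim_unique _ D); rewrite /codim /dim.
  by apply: (@xgetPex _ 0%N [set k | is_dim _ k]%classic); exists #|Q|.
exists b; split=> [k|c cb k|_ [f Pf <-]].
- exists (cycle_prod (@Xvar n K) (enum_val k)) => //.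
  exact/lin_span_mem/cycle_prod_multilinear.
- pose c' r := \sum_(k | enum_val k == r) c k.
  have -> : c k = c' (enum_val k).
    rewrite /c' (big_pred1 k)// => j.
    by rewrite (inj_eq enum_val_inj).
  have kQ : Q (enum_val k) := enum_valP k.
  apply: (identities_W_coef s0 kQ) => //; rewrite -/W.
  rewrite -[X in identities _ X]subr0; apply/relfree_eqP.
  rewrite (lin0 pl) (big_morph _ (linD pl) (lin0 pl)) -[RHS]cb.
  rewrite [RHS](partition_big (@enum_val _ Q) xpredT)//=.
  apply: eq_bigr => r _; rewrite (linZ pl) scaler_suml.
  by apply: eq_bigr => j /eqP <-.
- apply: (lin_span_image pl) (P_span_cycle_prod Pf) => _ [r _ <-].
  have [rQ|/negbTE rQ] := boolP (Q r).
    apply: lin_span_mem; exists (enum_rank_in rQ r) => //.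
    by rewrite /b enum_rankK_in.
  have -> : relfree_pi W (cycle_prod (@Xvar n K) r) = 0.
    rewrite -(lin0 pl); apply/relfree_eqP; rewrite subr0 => A WA h hP.
    by rewrite cycle_prod_morph// (cycle_prod_eq0 _ WA)// leqNgt -/(Q r) [X in ~~ X]rQ.
  exact: lin_span0.
Qed.

(** * Counting permutations by their nontrivial cycles *)

Section CycleCount.
Local Open Scope nat_scope.
Variable N : nat.
Implicit Types (s : 'S_N) (i j z : 'I_N) (Q : pred 'I_N).

Definition fixed_in Q s : nat := \sum_(i | Q i) (s i == i).

Lemma porbit_orbit s i : porbit s i =i orbit s i.
Proof.
move=> j; rewrite -fconnect_orbit; apply/porbitP/idP => [[k ->]|/iter_findex <-].
  by rewrite permX fconnect_iter.
by eexists; rewrite permX.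
Qed.

Lemma card_orbit_min s : #|orbit_min s| = #|porbits s|.
Proof.
rewrite -(@card_in_imset _ _ (porbit s)) => [|i i' mi mi' ii'].
  apply: eq_card => C; apply/imsetP/imsetP => [[i _ ->]|[j _ ->]].
    by exists i.
  have [i mi ji] := orbit_min_ex s j; exists i => //.
  by apply/eqP; rewrite eq_porbit_mem porbit_orbit.
apply: (orbit_min_inj mi mi' (in_orbit _ _)).
by rewrite -porbit_orbit -ii' porbit_id.
Qed.

Lemma nt_cyclesE s : (nt_cycles s + fixed_in xpredT s) = #|porbits s|.
Proof.
rewrite -card_orbit_min -sum1_card (bigID (fun i => s i == i) (orbit_min s)) /=.
rewrite addnC; congr (_ + _); last by rewrite /nt_cycles -sum1_card.
rewrite /fixed_in big_mkcond [RHS]big_mkcond; apply: eq_bigr => i _ /=.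
have [sii|] := eqVneq (s i) i; rewrite ?andbF// andbT.
suff mi : orbit_min s i by case: ifP => // /negP[].
have c : fcycle s [:: i] by rewrite /= sii eqxx.
apply/orbit_minP => j; rewrite (orbitE c _ (mem_head _ _)) //= eqxx rot0.
by rewrite inE => /eqP ->.
Qed.

(** Multiplying by a transposition inserts the fixed point z of s into the cycle
    of j. *)
Section Insertion.
Variables (s : 'S_N) (z j : 'I_N).
Hypotheses (sz : s z = z) (jz : j != z).

Let s' : 'S_N := (tperm j z * s)%g.

Lemma fixed_in_insert Q : Q z -> Q j ->
  (fixed_in Q s' + (s j == j) + 1) = fixed_in Q s.
Proof.
move=> Qz Qj; rewrite /fixed_in !(bigD1 z Qz) /=.
rewrite !(bigD1 j (_ : Q j && (j != z))) ?Qj//=.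
rewrite !permM tpermL tpermR sz eqxx (eq_sym z j) (negPf jz).
have -> : (s j == z) = false.
  by apply: contraNF jz => /eqP sj; apply/eqP/(@perm_inj _ s); rewrite sj sz.
rewrite !add0n [RHS]addnC [X in (_ = X + 1)]addnC; congr (_ + _ + _).
apply: eq_bigr => i /andP[/andP[_ iz] ij].
by rewrite permM tpermD// eq_sym.
Qed.

(** The number of all cycles drops by one, and the number of fixed points by one
    for z and by another one if j was fixed; nontrivial cycles are the
    difference. *)
Lemma nt_cycles_insert : nt_cycles s' = (nt_cycles s + (s j == j)).
Proof.
have := porbits_mul_tperm s j z; rewrite /= jz -/s'.
have -> : j \notin porbit s z.
  rewrite porbit_orbit; have c : fcycle s [:: z] by rewrite /= sz eqxx.
  by rewrite (orbitE c _ (mem_head _ _)) //= eqxx rot0 inE.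
rewrite -!nt_cyclesE -(@fixed_in_insert xpredT)//; lia.
Qed.

End Insertion.

(** The symmetric group on the points below m is realized inside 'S_N, so that
    insertion needs no change of type. *)
Definition fixed_from m : pred 'S_N :=
  fun s => [forall i : 'I_N, (m <= i) ==> (s i == i)].

Lemma fixed_fromP m s :
  reflect (forall i, (m <= i) -> s i = i) (fixed_from m s).
Proof.
by apply: (iffP forallP) => H i; [move=> mi; apply/eqP/(implyP (H i))
  | apply/implyP => mi; apply/eqP/H].
Qed.

(** The pair attached to a permutation s is recovered as j = s^-1 z together
    with tperm j z * s. The choice j = z leaves z fixed. *)
Lemma sum_fixed_from_succ z (G : 'S_N -> nat) :
  \sum_(s | fixed_from z.+1 s) G s =
  \sum_(s | fixed_from z s) \sum_(j : 'I_N | j <= z) G (tperm j z * s)%g.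
Proof.
rewrite pair_big /=.
rewrite (reindex_onto (fun p : 'S_N * 'I_N => (tperm p.2 z * p.1)%g)
   (fun s => (tperm ((s^-1)%g z) z * s, (s^-1)%g z)%g)) /= => [|s _]; last first.
  by rewrite mulgA tperm2 mul1g.
apply: eq_bigl => -[s j] /=; apply/andP/andP.
- move=> [/fixed_fromP fs /eqP[] _ jE].
  have sz : s z = z.
    have := permKV (tperm j z * s)%g z.
    by rewrite jE permM tpermL.
  have jz : (j <= z).
    rewrite leqNgt; apply/negP => zj; have := fs j zj.
    by rewrite permM tpermL sz => zE; move: zj; rewrite zE ltnn.
  split=> //; apply/fixed_fromP => i; rewrite leq_eqVlt => /predU1P[/val_inj <-//|zi].
  have := fs i zi; rewrite permM tpermD//.
    by apply: contraTneq zi => <-; rewrite -leqNgt.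
  by apply: contraTneq zi => <-; rewrite ltnn.
- move=> [/fixed_fromP fs jz].
  have jE : ((tperm j z * s)^-1)%g z = j.
    by apply: (canLR (permK _)); rewrite permM tpermL fs.
  rewrite jE mulgA tperm2 mul1g eqxx; split=> //.
  apply/fixed_fromP => i zi; rewrite permM tpermD ?fs//; first exact: ltnW.
    by apply: contraTneq zi => <-; rewrite -leqNgt.
  by apply: contraTneq zi => <-; rewrite ltnn.
Qed.

Definition fixed_below m s := fixed_in (fun i => (i < m)) s.

Definition count_fixed m k f : nat :=
  \sum_(s | fixed_from m s) ((nt_cycles s == k) && (fixed_below m s == f)).

(** The three terms come from adding the new point m as a fixed point, inserting
    it into a nontrivial cycle, which has m - f places, and turning one of f + 1
    fixed points into a cycle of length 2. *)
Lemma count_fixedS m k f : (m < N) ->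
  count_fixed m.+1 k f =
  ((if f is f'.+1 then count_fixed m k f' else 0)
   + (m - f) * count_fixed m k f
   + (if k is k'.+1 then f.+1 * count_fixed m k' f.+1 else 0)).
Proof.
move=> mN; pose z := Ordinal mN; rewrite {1}/count_fixed (sum_fixed_from_succ z).
pose I s k f : nat := (nt_cycles s == k) && (fixed_below m s == f).
transitivity (\sum_(s | fixed_from m s)
   ((if f is f'.+1 then I s k f' else 0) + (m - f) * I s k f +
    (if k is k'.+1 then f.+1 * I s k' f.+1 else 0))); last first.
  rewrite !big_split /= -big_distrr /=; congr (_ + _ + _).
    by case: f => //; rewrite big1_eq.
  by case: k => [|k]; rewrite ?big1_eq// -big_distrr.
apply: eq_bigr => s /fixed_fromP fs; have sz : s z = z by apply: fs.
rewrite (bigD1 z)//= tperm1 mul1g.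
have -> : fixed_below m.+1 s = (fixed_below m s).+1.
  rewrite /fixed_below /fixed_in (bigD1 z)//= sz eqxx add1n; congr _.+1.
  apply: eq_bigl => i; rewrite ltnS ltn_neqAle andbC -(inj_eq val_inj)//.
transitivity (((nt_cycles s == k) && ((fixed_below m s).+1 == f)) +
  \sum_(j : 'I_N | j < m) if s j == j
     then ((nt_cycles s).+1 == k) && (fixed_below m s == f.+1) : nat
     else I s k f).
  congr (_ + _); apply: eq_big => j.
    by rewrite ltn_neqAle andbC -(inj_eq val_inj).
  move=> /andP[jz' jz]; have jm : (j < m).
    by rewrite ltn_neqAle jz' andbT; rewrite -(inj_eq val_inj) in jz.
  rewrite nt_cycles_insert//.
  have : (fixed_below m.+1 (tperm j z * s)%g + (s j == j) + 1)
          = fixed_below m.+1 s.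
    by apply: fixed_in_insert; rewrite //= ltnS.
  have -> : fixed_below m.+1 s = (fixed_below m s).+1.
    rewrite /fixed_below /fixed_in (bigD1 z)//= sz eqxx add1n; congr _.+1.
    apply: eq_bigl => i; rewrite ltnS ltn_neqAle andbC -(inj_eq val_inj)//.
  rewrite /I; case: (s j == j); rewrite ?addn0 ?addn1 => -[<-].
    by rewrite eqSS.
  by [].
rewrite (bigID (fun j => s j == j)) /=.
rewrite (eq_bigr (fun=> ((nt_cycles s).+1 == k) && (fixed_below m s == f.+1) : nat));
  last by move=> j /andP[_ ->].
rewrite [X in _ + (_ + X)](eq_bigr (fun=> I s k f)); last first.
  by move=> j /andP[_ /negPf ->].
rewrite !sum_nat_cond_const.
have cfix : #|[set j : 'I_N | j < m & s j == j]| = fixed_below m s.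
  rewrite -sum1_card /fixed_below /fixed_in big_mkcond [RHS]big_mkcond.
  by apply: eq_bigr => j _; rewrite inE; case: (j < m); case: (s j == j).
have cnfix : #|[set j : 'I_N | j < m & s j != j]| = m - fixed_below m s.
  apply/esym/(canLR (addKn _)); rewrite -cfix -!sum1_card.
  transitivity (\sum_(j : 'I_N | j < m) 1).
    by rewrite (big_ord_narrow (ltnW mN)) sum_nat_const card_ord muln1.
  rewrite (bigID (fun j => s j == j)) /=; congr (_ + _);
    by apply: eq_bigl => j; rewrite inE.
rewrite cfix cnfix [X in _ + X = _]addnC addnA; congr (_ + _ + _).
- by case: f => [|f]; rewrite ?andbF ?eqSS.
- by rewrite /I; case: (fixed_below m s =P f) => [->//|_]; rewrite andbF !muln0.
- case: k => [|k]; first by rewrite muln0.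
  by rewrite /I eqSS; case: (fixed_below m s =P f.+1) => [->//|_]; rewrite andbF !muln0.
Qed.

Lemma count_fixed0 k f : count_fixed 0 k f = ((k == 0) && (f == 0)).
Proof.
rewrite /count_fixed (big_pred1 1%g) => [|s]; last first.
  apply/fixed_fromP/eqP => [fs|-> i _]; last by rewrite perm1.
  by apply/permP => i; rewrite perm1 fs.
have -> : nt_cycles (1%g : 'S_N) = 0.
  by apply: eq_card0 => i; rewrite -topredE /= /nontrivial_min perm1 eqxx andbF.
by rewrite /fixed_below /fixed_in big_pred0// !(eq_sym 0).
Qed.

Lemma count_fixed_sum k :
  #|[pred s : 'S_N | nt_cycles s == k]| = \sum_(f < N.+1) count_fixed N k f.
Proof.
rewrite exchange_big /= -sum1_card big_mkcond /=.
rewrite [RHS](eq_bigl xpredT) => [|s]; last by apply/fixed_fromP => i; rewrite leqNgt ltn_ord.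
apply: eq_bigr => s _; rewrite inE.
have fN : fixed_below N s < N.+1.
  rewrite ltnS -[leqRHS]card_ord -sum1_card /fixed_below /fixed_in.
  rewrite [leqRHS](bigID (fun i : 'I_N => i < N)) /= -[leqLHS]addn0.
  by apply: leq_add => //; apply: leq_sum => i _; case: (s i == i).
rewrite (bigD1 (Ordinal fN))//= eqxx andbT big1 => [|f]; first by case: eqP.
by rewrite -(inj_eq val_inj) eq_sym /= => /negPf ->; rewrite andbF.
Qed.

End CycleCount.

(** * Generating functions *)

Section Euler.
Variable R : comNzRingType.
Implicit Types f g : fps R.

Lemma fps_coef_sum (I : Type) (r : seq I) (P : pred I) (F : I -> fps R) n :
  fps_coef (\sum_(i <- r | P i) F i) n = \sum_(i <- r | P i) fps_coef (F i) n.
Proof. by rewrite (big_morph (fun f => fps_coef f n) (id1 := 0) (op1 := +%R))//; case: n. Qed.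

Lemma fps_coef_zM f n :
  fps_coef (fps_z R * f) n = if n is n'.+1 then fps_coef f n' else 0.
Proof.
case: n => [|n]; first by rewrite /= big_ord1 mul0r.
rewrite /= big_ord_recl mul0r add0r big_ord_recl /= mul1r subn1 big1 ?addr0//.
by move=> i _; rewrite mul0r.
Qed.

(** The derivation z d/dz. *)
Definition fps_euler f : fps R := Fps (fun n => n%:R * fps_coef f n).

Lemma fps_eulerM f g : fps_euler (f * g) = fps_euler f * g + f * fps_euler g.
Proof.
apply: fps_eqP => n; rewrite /= mulr_sumr -big_split /=; apply: eq_bigr => i _.
have i_n : (i <= n)%N by rewrite -ltnS.
by rewrite -{1}(subnKC i_n) natrD mulrDl mulrA (mulrCA _ (fps_coef f i)).
Qed.

Lemma fps_eulerX f k : fps_euler (f ^+ k.+1) = fps_euler f * (f ^+ k *+ k.+1).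
Proof.
elim: k => [|k IHk]; first by rewrite expr1 expr0 mulr1.
by rewrite exprS fps_eulerM IHk mulrCA -mulrDr [f * _]mulrnAr -exprS -mulrS.
Qed.

Lemma fps_eulerZ a f : fps_euler (a *: f) = a *: fps_euler f.
Proof. by apply: fps_eqP => n; rewrite /= mulrCA. Qed.

End Euler.

(** The exponential generating function of the permutations without fixed points
    having k cycles. *)
Definition fps_cycles k : fps rat := (k`!%:R)^-1 *: fps_harmonic 2 ^+ k.

Lemma natr_fact_neq0 n : n`!%:R != 0 :> rat.
Proof. by rewrite Num.Theory.pnatr_eq0 -lt0n fact_gt0. Qed.

Lemma fps_cycles0 : fps_cycles 0 = 1.
Proof. by rewrite /fps_cycles expr0 invr1 scale1r. Qed.

(** It rests on (1 - z) z H' = z^2 for H = z^2/2 + z^3/3 + ... *)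
Lemma fps_cycles_euler k :
  (1 - fps_z rat) * fps_euler (fps_cycles k.+1) =
  fps_z rat * (fps_z rat * fps_cycles k).
Proof.
have HE : (1 - fps_z rat) * fps_euler (fps_harmonic 2) = fps_z rat * fps_z rat.
  apply: fps_eqP => n; rewrite mulrBl mul1r.
  rewrite [LHS]/(_ + - fps_coef (_ * _) n) !fps_coef_zM.
  case: n => [|[|[|n]]] /=; rewrite ?mulr0 ?mul0r ?subr0 ?oppr0//.
  by rewrite !divff ?subrr ?Num.Theory.pnatr_eq0.
rewrite /fps_cycles fps_eulerZ fps_eulerX -!scalerAr mulrA.
rewrite [(1 - _) * _]mulrA HE mulrnAr -scaler_nat scalerA; congr (_ *: _).
rewrite factS natrM invfM mulrAC mulVf ?mul1r//.
by rewrite Num.Theory.pnatr_eq0.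
Qed.

Lemma fps_cycles_rec k m :
  m.+1%:R * fps_coef (fps_cycles k) m.+1 =
  m%:R * fps_coef (fps_cycles k) m +
  (if k is k'.+1 then if m is m'.+1 then fps_coef (fps_cycles k') m' else 0
   else 0).
Proof.
case: k => [|k]; first by rewrite fps_cycles0; case: m => [|m]; rewrite !(mul0r, mulr0) addr0.
have /(congr1 (fun f => fps_coef f m.+1)) := fps_cycles_euler k.
rewrite mulrBl mul1r [LHS]/(_ + - fps_coef (_ * _) m.+1) !fps_coef_zM => /eqP.
by rewrite subr_eq addrC => /eqP.
Qed.

Lemma fps_cycles_small k n : (n < k)%N -> fps_coef (fps_cycles k) n = 0.
Proof.
move=> nk; pose G := Fps (fun n => fps_coef (fps_harmonic 2) n.+1).
have HE : fps_harmonic 2 = fps_z rat * G.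
  by apply: fps_eqP => j; rewrite fps_coef_zM; case: j.
rewrite /fps_cycles HE exprMn [LHS]/(_ * fps_coef _ n).
suff -> : forall f, fps_coef (fps_z rat ^+ k * f) n = 0 by exact: mulr0.
elim: k n nk => // k IHk [|n] nk f; rewrite exprS -mulrA fps_coef_zM//.
exact: IHk.
Qed.

(** A permutation of m points with f fixed points and k nontrivial cycles is a
    choice of the fixed points and a permutation of the others without fixed
    points; hence the closed form m!/f! times a coefficient of H^k/k!, which
    satisfies the recursion of [count_fixedS] by [fps_cycles_rec]. *)
Lemma count_fixed_coef n m k f : (m <= n)%N ->
  f`!%:R * (count_fixed n m k f)%:R =
  (if (f <= m)%N then m`!%:R * fps_coef (fps_cycles k) (m - f) else 0) :> rat.
Proof.
elim: m k f => [|m IHm] k f mn.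
  rewrite count_fixed0; case: f => [|f]; last by rewrite andbF mulr0.
  rewrite leqnn !mul1r andbT subnn.
  by case: k => [|k]; rewrite ?fps_cycles0// fps_cycles_small.
have {}IHm k' f' := IHm k' f' (ltnW mn).
rewrite count_fixedS// 2!natrD 2!mulrDr natrM.
have t1 : f`!%:R * (if f is f'.+1 then count_fixed n m k f' else 0)%:R =
    (if (f <= m.+1)%N then f%:R * (m`!%:R * fps_coef (fps_cycles k) (m.+1 - f)) else 0) :> rat.
  case: f => [|f]; first by rewrite mul0r mulr0.
  by rewrite factS natrM -mulrA IHm ltnS subSS; case: ifP => //; rewrite mulr0.
have t2 : f`!%:R * ((m - f)%:R * (count_fixed n m k f)%:R) =
    (if (f <= m)%N then (m - f)%:R * (m`!%:R * fps_coef (fps_cycles k) (m - f)) else 0) :> rat.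
  by rewrite mulrCA IHm; case: ifP => //; rewrite mulr0.
have t3 : f`!%:R * (if k is k'.+1 then f.+1 * count_fixed n m k' f.+1 else 0)%N%:R =
    (if k is k'.+1 then if (f < m)%N then
       m`!%:R * fps_coef (fps_cycles k') (m - f.+1) else 0 else 0) :> rat.
  case: k {t1 t2} => [|k]; first by rewrite mulr0.
  by rewrite natrM mulrA -natrM mulnC -factS IHm.
rewrite t1 t2 t3; case: (ltngtP f m.+1) => [|fm|->]; last 2 first.
- rewrite leqNgt (ltnW fm) /= add0r ltnNge (ltnW (ltnW fm)) /=.
  by case: (k).
- rewrite ltnn (_ : m.+1 < m = false)%N; last by rewrite ltnNge leqnSn.
  by rewrite factS natrM mulrA; case: (k) => [|k'] /=; rewrite !addr0.
rewrite ltnS => fm; rewrite fm subSn//.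
have := fps_cycles_rec k (m - f); set x := fps_coef _ _.+1.
have -> : (m - f).+1%:R = m.+1%:R - f%:R :> rat.
  by rewrite -subSn// natrB// (leq_trans fm).
rewrite mulrBl => /eqP; rewrite subr_eq => /eqP E.
rewrite factS natrM -mulrA (mulrCA m.+1%:R) E !mulrDr -addrA addrC.
congr (_ + _); last by rewrite mulrCA.
rewrite (mulrCA (m - f)%:R); congr (_ + _).
case: (k) => [|k']; first by rewrite mulr0.
case: ltnP => [fm'|mf].
  by rewrite -(subnSK fm').
by rewrite (_ : m - f = 0)%N ?mulr0//; apply/eqP; rewrite subn_eq0.
Qed.

Lemma count_cycles n s :
  #|[pred r : 'S_n | (nt_cycles r < s)%N]|%:R / n`!%:R =
  fps_coef (fps_exp * \sum_(0 <= k < s) fps_cycles k) n.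
Proof.
rewrite mulr_sumr fps_coef_sum big_mkord.
have -> : #|[pred r : 'S_n | (nt_cycles r < s)%N]| =
    (\sum_(k < s) #|[pred r : 'S_n | nt_cycles r == k]|)%N.
  under eq_bigr do rewrite -sum1_card big_mkcond /=.
  rewrite exchange_big -sum1_card big_mkcond /=; apply: eq_bigr => r _.
  rewrite inE; case: ltnP => rs.
    rewrite (bigD1 (Ordinal rs))//= inE eqxx big1 // => k.
    by rewrite inE -(inj_eq val_inj) eq_sym /= => /negPf ->.
  by rewrite big1// => k _; rewrite inE gtn_eqF// (leq_trans _ rs).
rewrite natr_sum mulr_suml; apply: eq_bigr => k _.
rewrite count_fixed_sum natr_sum mulr_suml /=; apply: eq_bigr => f _.
have := @count_fixed_coef n n k f (leqnn n); rewrite -ltnS ltn_ord => E.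
apply: (mulfI (natr_fact_neq0 f)); rewrite mulrA E mulrAC.
rewrite divff ?natr_fact_neq0// mul1r; apply/esym.
exact: (mulVKf (natr_fact_neq0 f)).
Qed.

Lemma complexityE (K : fieldType) s : (0 < s)%N ->
  complexity (@W_ K s) = fps_exp * \sum_(0 <= k < s) fps_cycles k.
Proof.
by move=> s0; apply: fps_eqP => n; rewrite -count_cycles [LHS]/= codimE.
Qed.

(** A permutation of n points has at most n nontrivial cycles, so for m > n all
    n! permutations are counted. *)
Lemma fps_exp_cycles n m : (n < m)%N ->
  fps_coef (fps_exp * \sum_(0 <= k < m) fps_cycles k) n = 1.
Proof.
move=> nm; rewrite -count_cycles.
rewrite (@eq_card _ _ 'S_n) => [|r]; first by rewrite card_Sn divff ?natr_fact_neq0.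
rewrite !inE (leq_ltn_trans _ nm)//.
by rewrite -[leqRHS]card_ord max_card.
Qed.

Lemma fps_cycles_sum_stable s m m' n : (s <= m)%N -> (n < m)%N -> (m <= m')%N ->
  fps_coef (\sum_(s <= k < m') fps_cycles k) n =
  fps_coef (\sum_(s <= k < m) fps_cycles k) n.
Proof.
move=> sm nm mm'; rewrite (big_cat_nat sm mm') /= [X in _ + X = _]fps_coef_sum.
rewrite [X in _ + X](_ : _ = 0) ?addr0//.
rewrite big_nat_cond big1// => k /andP[/andP[mk _] _].
by rewrite fps_cycles_small// (leq_trans nm).
Qed.

Theorem theorem7p1 (K : fieldType) (s : nat) (hs : (2 <= s)%N) :
  complexity (@W_ K s) =
    fps_exp * (1 + \sum_(1 <= k < s)
                     (k`!%:R)^-1 *: (- fps_z rat + fps_mln1Bz) ^+ k) /\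
  exists T : fps rat,
    fps_sums s (fun k => (k`!%:R)^-1 *: fps_harmonic 2 ^+ k) T /\
    complexity (@W_ K s) = (1 - fps_z rat)^-1 - fps_exp * T.
Proof.
have s0 : (0 < s)%N by apply: ltnW.
rewrite complexityE//; split.
  have -> : - fps_z rat + fps_mln1Bz = fps_harmonic 2.
    apply: fps_eqP => -[|[|n]] /=; rewrite ?oppr0 ?addr0 ?add0r//.
  by rewrite big_ltn// fps_cycles0.
(* The powers of H from the (n+1)-st on have zero coefficient at z^n. *)
pose T := Fps (fun n =>
  fps_coef (\sum_(s <= k < maxn s n.+1) fps_cycles k) n).
exists T; split=> [n|].
  exists (maxn s n.+1) => m; apply: fps_cycles_sum_stable.
    exact: leq_maxl.
  exact: leq_maxr.
rewrite fps_inv1Bz; apply: fps_eqP => n; set M := maxn s n.+1.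
have -> : fps_coef (Fps (fun=> 1) - fps_exp * T) n = 1 - fps_coef (fps_exp * T) n by [].
have -> : fps_coef (fps_exp * T) n =
    fps_coef (fps_exp * \sum_(s <= k < M) fps_cycles k) n.
  rewrite /=; apply: eq_bigr => i _; congr (_ * _).
  apply/esym/fps_cycles_sum_stable; [exact: leq_maxl|exact: leq_maxr|].
  by rewrite geq_max leq_maxl (leq_trans _ (leq_maxr _ _))// ltnS leq_subr.
apply/eqP; rewrite eq_sym subr_eq; apply/eqP.
rewrite -(@fps_exp_cycles n M); last exact: leq_maxr.
by rewrite (big_cat_nat (leq0n s) (leq_maxl s n.+1)) mulrDr.
Qed.
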